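(* Let $\mu,\nu\in\mathcal M_+(\Omega)$ and let $\varphi_0,\psi_0$ be the optimal dual potentials for $\mathrm{UOT}(\mu,\nu)$. Assume that Assumptions (A1), (A2), (A3) of the context hold. Let $\zeta_0=1-e^{-\varphi_0}$, $\xi_0=1-e^{-\psi_0}$, and let $\bar\mu_n,\bar\nu_m,\tilde\mu_n,\tilde\nu_m$ be the empirical measures defined in the context. Then there exists a constant $C_\Lambda$ (not depending on $n,m$ or the samples) such that $$\mathrm{UOT}(\tilde\mu_n,\tilde\nu_m)-\mathrm{UOT}(\mu,\nu)\le\int\zeta_0\,d(\tilde\mu_n-\mu)+\int\xi_0\,d(\tilde\nu_m-\nu)+C_\Lambda\bigl(M_\mu W_2^2(\bar\mu_n,\bar\mu)+M_\nu W_2^2(\bar\nu_m,\bar\nu)\bigr).$$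
   Context: **Unbalanced optimal transport (UOT).** $\Omega\subset\mathbb R^d$ is bounded and convex; $\mathcal M_+(\Omega)$ is the set of finite positive Radon measures on $\Omega$. $D_{\mathrm{KL}}(\eta\mid\sigma)=\int (f\log f-f+1)\,d\sigma$ if $\eta=f\sigma$ (with $0\log0=0$), and $+\infty$ otherwise. For $\gamma\in\mathcal M_+(\Omega\times\Omega)$, $\gamma_0,\gamma_1$ are its marginals. Define $$\mathrm{UOT}(\mu,\nu)=\inf_{\gamma\in\mathcal M_+(\Omega\times\Omega)}\Bigl\{\int \tfrac12\|x-y\|^2d\gamma+D_{\mathrm{KL}}(\gamma_0\mid\mu)+D_{\mathrm{KL}}(\gamma_1\mid\nu)\Bigr\}=\sup\Bigl\{\int(1-e^{-\varphi})d\mu+\int(1-e^{-\psi})d\nu\Bigr\},$$ the supremum (dual problem) being over $(\varphi,\psi)\in C_b(\Omega)^2$ with $\varphi(x)+\psi(y)\le\frac12\|x-y\|^2$. With $\varphi^c(x)=\inf_{y\in\Omega}\{\frac12\|x-y\|^2-\varphi(y)\}$, a function is $c$-concave if it is of the form $\psi^c$. When $\mu$ has an a.e. positive density and $\nu\ll dx$, there is a $\mu$-a.e. unique $c$-concave $\varphi_0$ such that $(\varphi_0,\psi_0)$ with $\psi_0=\varphi_0^c$ solves the dual problem; these are the optimal dual potentials. **Empirical measures.** $M_\mu=\mu(\Omega)$, $M_\nu=\nu(\Omega)$, $\bar\mu=\mu/M_\mu$, $\bar\nu=\nu/M_\nu$; $X_1,\dots,X_n\sim\bar\mu$ and $Y_1,\dots,Y_m\sim\bar\nu$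 are mutually independent; $\bar\mu_n=\frac1n\sum_i\delta_{X_i}$, $\bar\nu_m=\frac1m\sum_j\delta_{Y_j}$, $\tilde\mu_n=M_\mu\bar\mu_n$, $\tilde\nu_m=M_\nu\bar\nu_m$. $W_2$ is the 2-Wasserstein distance for the Euclidean norm. **Assumptions.** (A1) There is $\kappa\in(0,1)$ with $(1-\frac1\kappa)I\preceq\nabla^2\varphi_0(x)\preceq(1-\kappa)I$ for all $x\in\Omega$. (A2) $\Omega$ is compact, convex, and there are $\epsilon_0,\delta_0>0$ with $\mathrm{Vol}(B(x,\epsilon)\cap\Omega)\ge\delta_0\mathrm{Vol}(B(x,\epsilon))$ for all $x\in\Omega$, $\epsilon\in(0,\epsilon_0)$. (A3) $\bar\mu,\bar\nu$ have Lebesgue densities $p,q$ with $0<\beta_{\min}\le p,q\le\beta_{\max}<\infty$ on $\Omega$. *)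

(* Defs.v *)
From HB Require Import structures.
From mathcomp Require Import all_boot all_order all_algebra.
From mathcomp Require Import all_classical all_reals all_analysis.
From mathcomp Require Import measurable_realfun.

Set Implicit Arguments.
Unset Strict Implicit.
Unset Printing Implicit Defensive.

Import Order.TTheory GRing.Theory Num.Theory.
Import numFieldNormedType.Exports.

Local Open Scope classical_set_scope.
Local Open Scope ring_scope.

(* The Borel sigma-algebra; R^d is 'rV[R]_d. *)
HB.instance Definition _ (R : realType) (m n : nat) :=
  Measurable.copy 'M[R]_(m, n) (g_sigma_algebraType (@open 'M[R]_(m, n))).

Section lebesgue_measure_rV.
Context {R : realType}.

Definition cons_rV d (z : measurableTypeR R * 'rV[R]_d) : 'rV[R]_d.+1 :=
  \row_(i < d.+1) (if unlift ord0 i is Some j then z.2 0 j else z.1).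

Lemma measurable_coord_rV d (i : 'I_d) :
  measurable_fun setT (fun v : 'rV[R]_d => v 0 i).
Proof.
apply: (measurability _ (RGenOpens.measurableE R)) => _ [_ [a [b ->]] <-].
rewrite setTI; apply: sub_sigma_algebra; apply: open_comp => //.
by move=> x _; exact: coord_continuous.
Qed.

Let ratbox d (kq : nat * 'rV[rat]_d) : set 'rV[R]_d :=
  ball (map_mx ratr kq.2 : 'rV[R]_d) kq.1.+1%:R^-1.

Let open_ratbox d (U : set 'rV[R]_d) : open U ->
  U = \bigcup_(kq in [set kq | ratbox kq `<=` U]) ratbox kq.
Proof.
move=> oU; apply/seteqP; split => [x Ux|x [kq kqU]]; last exact: kqU.
have /nbhs_ballP[e /= e0 xeU] := open_nbhs_nbhs (conj oU Ux).
have [k ke] : exists k : nat, k.+1%:R^-1 < e / 2.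
  by have [k _ /(_ _ (leqnn k))] := near_infty_natSinv_lt (PosNum (divr_gt0 e0 (ltr0n R 2))); exists k.
have H i : exists q : rat, `|x 0 i - ratr q| < k.+1%:R^-1.
  have [|q] := @rat_in_itvoo R (x 0 i - k.+1%:R^-1) (x 0 i + k.+1%:R^-1).
    by rewrite ltrD2l gtrN// invr_gt0 ltr0n.
  rewrite in_itv/= => /andP[q1 q2]; exists q.
  by rewrite ltr_distl ltrBlDr q2/= -ltrBlDr// andbT.
have [q Hq] := choice H.
exists (k, \row_i q i) => [y /=|]; last first.
  by split; [rewrite invr_gt0 ltr0n|move=> i j; rewrite ord1 /ball/= !mxE distrC; exact: Hq].
move=> [_ By]; apply: xeU; split => // i j.
have := By i j; rewrite ord1 /ball/= !mxE => yq.
rewrite (splitr e) -(subrKA (ratr (q j))).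
by rewrite (le_lt_trans (ler_normD _ _))// ltrD// (lt_trans _ ke)//.
Qed.

Lemma measurable_cons_rV d : measurable_fun setT (@cons_rV d).
Proof.
have mcoord j : measurable_fun setT (fun z => cons_rV (d := d) z 0 j).
  under eq_fun do rewrite mxE.
  case: unliftP => [k _|_]; last exact: measurable_fst.
  by apply: (measurableT_comp (measurable_coord_rV k)); exact: measurable_snd.
apply: (@measurability _ _ _ _ _ _ (@open 'rV[R]_d.+1)) => // _ [U oU <-].
rewrite setTI (open_ratbox oU) preimage_bigcup bigcup_mkcond.
apply: countable_bigcupT_measurable => // -[k q].
case: ifPn => // _.
rewrite (_ : _ @^-1` _ = \bigcap_(j in [set: 'I_d.+1])
    ((fun z => cons_rV (d := d) z 0 j) @^-1`
      (ball (ratr (q 0 j) : R) k.+1%:R^-1))).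
  apply: fin_bigcap_measurable => // j _.
  rewrite -[X in measurable X]setTI; apply: mcoord => //.
  exact: measurable_ball.
apply/seteqP; split => [z [_ zB] j _|z zB]; first by have := zB 0 j; rewrite mxE.
split=> [|i j]; first by rewrite invr_gt0 ltr0n.
by rewrite ord1 mxE; exact: zB.
Qed.

(* d-dimensional Lebesgue measure, as the iterated product of the
   one-dimensional one. *)
Fixpoint lebesgue_rV d : set 'rV[R]_d -> \bar R :=
  if d is d'.+1 then
    pushforward (lebesgue_measure \x^ @lebesgue_rV d')%E (@cons_rV d')
  else \d_(0 : 'rV[R]_0).

Let lebesgue_rV_measure d :
  exists m : {measure set 'rV[R]_d -> \bar R}, @lebesgue_rV d = m.
Proof.
elim: d => [|d [m mE]]; first by exists \d_(0 : 'rV[R]_0).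
pose p : {measure set (measurableTypeR R * 'rV[R]_d) -> \bar R} :=
  (lebesgue_measure \x^ m)%E.
exists (measure_function_pushforward__canonical__measure_function_Measure
  p (@measurable_cons_rV d)).
by rewrite /= mE.
Qed.

Let lebesgue_rV0 d : @lebesgue_rV d set0 = 0%E.
Proof. by have [m ->] := lebesgue_rV_measure d; rewrite measure0. Qed.

Let lebesgue_rV_ge0 d A : (0 <= @lebesgue_rV d A)%E.
Proof. by have [m ->] := lebesgue_rV_measure d; exact: measure_ge0. Qed.

Let lebesgue_rV_sigma_additive d : semi_sigma_additive (@lebesgue_rV d).
Proof.
have [m ->] := lebesgue_rV_measure d; exact: measure_semi_sigma_additive.
Qed.

HB.instance Definition _ d := isMeasure.Build _ _ _ (@lebesgue_rV d)
  (@lebesgue_rV0 d) (@lebesgue_rV_ge0 d) (@lebesgue_rV_sigma_additive d).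

End lebesgue_measure_rV.
Arguments lebesgue_rV {R d}.

Section euclidean.
Context {R : realType} {d : nat}.
Implicit Types (x y u v : 'rV[R]_d) (A B : 'M[R]_d).

Definition dotv u v : R := \sum_(i < d) u 0 i * v 0 i.

Definition norm2 u : R := Num.sqrt (dotv u u).

(* The library ball of 'rV[R]_d is the one of the sup norm. *)
Definition ball2 x (r : R) : set 'rV[R]_d := [set y | norm2 (y - x) < r].

Definition loewner_le A B := forall v, 0 <= dotv (v *m (B - A)) v.

(* First and second order differentiability of phi at every point of Omega,
   relative to Omega, so that boundary points are covered as well.  The row
   vector g x is the gradient and H x the Hessian matrix at x; its symmetry
   need not be required, it follows when Omega has nonempty interior.  The
   choice of the norm in the little-o is immaterial. *)
Definition gradient_on (Omega : set 'rV[R]_d) (phi : 'rV[R]_d -> R)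
    (g : 'rV[R]_d -> 'rV[R]_d) :=
  forall x, Omega x ->
    (fun y => phi y - phi x - dotv (g x) (y - x) : R^o)
      =o_ (within Omega (nbhs x)) (fun y => y - x).

Definition hessian_on (Omega : set 'rV[R]_d) (phi : 'rV[R]_d -> R)
    (H : 'rV[R]_d -> 'M[R]_d) :=
  exists2 g, gradient_on Omega phi g &
    forall x, Omega x ->
      (fun y => g y - g x - (y - x) *m H x)
        =o_ (within Omega (nbhs x)) (fun y => y - x).

End euclidean.

Section unbalanced_optimal_transport.
Context {R : realType} {d : nat}.
Local Notation E := 'rV[R]_d.
Implicit Types (Omega : set E) (phi psi : E -> R).
Local Open Scope ereal_scope.

(* Elements of M_+(Omega) are represented as finite Borel measures on R^d that
   vanish outside Omega; on R^d these are automatically Radon. *)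
Definition supported_on d' (T : measurableType d') (D : set T)
    (m : set T -> \bar R) := m (~` D) = 0.

Definition has_density (eta : set E -> \bar R) (sigma : {measure set E -> \bar R})
    (f : E -> R) :=
  [/\ measurable_fun setT f, forall x, (0 <= f x)%R &
    forall A, measurable A -> eta A = \int[sigma]_(x in A) (f x)%:E].

(* Since ln 0 = 0 in the library, the convention 0 log 0 = 0 is built in.
   A density is unique up to null sets, so the infimum ranges over at most one
   value; it is +oo when there is no density. *)
Definition KL (eta : set E -> \bar R) (sigma : {measure set E -> \bar R}) :
    \bar R :=
  ereal_inf [set \int[sigma]_x (f x * ln (f x) - f x + 1)%:E |
             f in has_density eta sigma].

Definition UOT Omega (mu nu : {measure set E -> \bar R}) : \bar R :=
  ereal_inf [set \int[gamma]_z (2^-1 * norm2 (z.1 - z.2) ^+ 2)%:E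
                 + KL (pushforward gamma fst) mu
                 + KL (pushforward gamma snd) nu |
    gamma in [set gamma : {finite_measure set (E * E)%type -> \bar R} |
              supported_on (Omega `*` Omega) gamma]].

Definition Cb Omega phi :=
  {within Omega, continuous phi} /\
  exists M : R, forall x, Omega x -> (`|phi x| <= M)%R.

Definition dual_admissible Omega : set ((E -> R) * (E -> R)) :=
  [set p | [/\ Cb Omega p.1, Cb Omega p.2 &
    forall x y, Omega x -> Omega y ->
      (p.1 x + p.2 y <= 2^-1 * norm2 (x - y) ^+ 2)%R]].

Definition dual_objective Omega (mu nu : {measure set E -> \bar R})
    (p : (E -> R) * (E -> R)) : \bar R :=
  \int[mu]_(x in Omega) (1 - expR (- p.1 x))%:E +
  \int[nu]_(y in Omega) (1 - expR (- p.2 y))%:E.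

Definition c_transform Omega (chi : E -> \bar R) (x : E) : \bar R :=
  ereal_inf [set (2^-1 * norm2 (x - y) ^+ 2)%:E - chi y | y in Omega].

Definition c_concave Omega phi :=
  exists chi : E -> \bar R,
    forall x, Omega x -> (phi x)%:E = c_transform Omega chi x.

Definition optimal_dual_potentials Omega (mu nu : {measure set E -> \bar R})
    phi psi :=
  [/\ dual_admissible Omega (phi, psi),
      dual_objective Omega mu nu (phi, psi) =
        ereal_sup [set dual_objective Omega mu nu p |
                   p in dual_admissible Omega],
      c_concave Omega phi &
      forall y, Omega y -> (psi y)%:E = c_transform Omega (EFin \o phi) y].

Definition coupling (alpha beta : set E -> \bar R)
    (pi : probability (E * E)%type R) :=
  forall A, measurable A ->
    pushforward pi fst A = alpha A /\ pushforward pi snd A = beta A.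

Definition W2 (alpha beta : set E -> \bar R) : \bar R :=
  poweR (ereal_inf [set \int[pi]_z (norm2 (z.1 - z.2) ^+ 2)%:E |
                    pi in coupling alpha beta]) 2^-1.

End unbalanced_optimal_transport.

Section empirical.
Context {R : realType} {d : nat}.
Local Notation E := 'rV[R]_d.
Local Open Scope ereal_scope.

Definition mass (mu : {measure set E -> \bar R}) : {nonneg R} :=
  NngNum (fine_ge0 (measure_ge0 mu setT)).

(* The default value \d_0 of mnormalize is irrelevant here: it is only used
   when mu has mass 0 or +oo. *)
Definition normalized (mu : {measure set E -> \bar R}) : probability E R :=
  mnormalize mu \d_(0%R : E).

Definition empirical n (x : 'I_n -> E) (A : set E) : \bar R :=
  (n%:R^-1)%:E * \sum_(i < n) \d_(x i) A.

Let empiricalE n (x : 'I_n -> E) : empirical x =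
  mscale (n%:R^-1)%:nng%R (msum (fun k => \d_(nth 0%R (map x (enum 'I_n)) k)) n).
Proof.
apply/funext => A; rewrite /empirical /mscale /msum/=; congr (_ * _).
by apply: eq_bigr => i _; rewrite (nth_map i) ?size_enum_ord// nth_ord_enum.
Qed.

Let empirical0 n (x : 'I_n -> E) : empirical x set0 = 0.
Proof. by rewrite empiricalE measure0. Qed.

Let empirical_ge0 n (x : 'I_n -> E) A : 0 <= empirical x A.
Proof. by rewrite empiricalE. Qed.

Let empirical_sigma_additive n (x : 'I_n -> E) :
  semi_sigma_additive (empirical x).
Proof. by rewrite empiricalE; exact: measure_semi_sigma_additive. Qed.

HB.instance Definition _ n (x : 'I_n -> E) := isMeasure.Build _ _ _
  (empirical x) (empirical0 x) (empirical_ge0 x) (@empirical_sigma_additive n x).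

End empirical.

Section independence.
Context {d : nat} {dT : measure_display} {T : measurableType dT} {R : realType}.
Local Notation E := 'rV[R]_d.
Local Open Scope ereal_scope.

Definition mutually_independent (P : probability T R) (I : finType)
    (Z : I -> T -> E) :=
  forall (J : {set I}) (A : I -> set E), (forall i, measurable (A i)) ->
    P (\bigcap_(i in [set i | i \in J]) (Z i @^-1` A i)) =
    \prod_(i in J) P (Z i @^-1` A i).

(* Two mutually independent samples of laws mubar and nubar, which are laws on
   Omega, so that the sample points lie in Omega. *)
Definition independent_samples Omega (mubar nubar : probability E R)
    (P : probability T R) n m
    (X : 'I_n -> {RV P >-> E}) (Y : 'I_m -> {RV P >-> E}) :=
  [/\ forall i w, Omega (X i w),
      forall j w, Omega (Y j w),
      forall i A, measurable A -> distribution P (X i) A = mubar A,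
      forall j A, measurable A -> distribution P (Y j) A = nubar A &
      mutually_independent P (fun k : 'I_n + 'I_m =>
        match k with inl i => X i : T -> E | inr j => Y j : T -> E end)].

End independence.

Section assumptions.
Context {R : realType} {d : nat}.
Local Notation E := 'rV[R]_d.

Definition hessian_bounds (Omega : set E) (phi : E -> R) :=
  exists kappa : R, 0 < kappa < 1 /\
  exists2 H, hessian_on Omega phi H &
    forall x, Omega x ->
      loewner_le (1 - kappa^-1)%:M (H x) /\ loewner_le (H x) (1 - kappa)%:M.

Definition regular_domain (Omega : set E) :=
  [/\ compact Omega, convex_set (Omega : set (convex_lmodType E)) &
    exists epsilon0 delta0 : R, [/\ 0 < epsilon0, 0 < delta0 &
      forall x epsilon, Omega x -> 0 < epsilon < epsilon0 ->
        (delta0%:E * lebesgue_rV (ball2 x epsilon)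
           <= lebesgue_rV (ball2 x epsilon `&` Omega))%E]].

Definition bounded_densities (Omega : set E) (mubar nubar : probability E R) :=
  exists p q : E -> R, exists beta_min beta_max : R,
    [/\ has_density mubar lebesgue_rV p, has_density nubar lebesgue_rV q,
        0 < beta_min &
        forall x, Omega x ->
          beta_min <= p x <= beta_max /\ beta_min <= q x <= beta_max].

End assumptions.

(* Main.v *)
(* Weak duality bounds [UOT mu nu] from below by the dual value of the optimal
   potentials, so it suffices to bound [UOT] of the empirical measures from above by
   a candidate plan.  By (A1), [cost x y - phi0 x] is strongly convex in [x], so each [y]
   has a unique contact point [S y] and [S] is Lipschitz; the first variation of the
   dual objective in the directions [(t h, - t (h o S) - O(t^2))] shows that [S]
   pushes [exp (- psi0) nu] forward to [exp (- phi0) mu].  Gluing this optimal plan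
   with couplings of [mu] and [nu] with their empirical measures gives the candidate.
   Its duality gap has two parts.  The transport part is at most quadratic in
   the displacements, because [cost - phi0 - psi0] vanishes to second order
   at almost every contact point: there its gradient in [x] is zero as soon as the
   contact point lies in the interior of [Omega] in the coordinate directions.  The
   entropic part is quadratic by a Bregman bound and Jensen's inequality, [exp (- phi0)]
   and [exp (- psi0)] being Lipschitz. *)
Require Import Defs.
From HB Require Import structures.
From mathcomp Require Import all_boot all_order all_algebra.
From mathcomp Require Import all_classical all_reals all_analysis.
From mathcomp Require Import measurable_realfun ring lra.

Set Implicit Arguments.
Unset Strict Implicit.
Unset Printing Implicit Defensive.

Import Order.TTheory GRing.Theory Num.Theory.
Import numFieldNormedType.Exports.

Local Open Scope classical_set_scope.
Local Open Scope ring_scope.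

(** No optimal plan is given: the hypothesis only says that the potentials are optimal in the dual
    problem, so the first variation has to supply the primal optimality condition. It rests on the
    slack [k / 2 * norm2 (x - S y) ^+ 2] that strong convexity leaves in the dual constraint: this
    pays for the difference between [h x] and [h (S y)]. The entropy of the candidate is finite only
    if its marginals live on the sample points. The mass at [(S y, y)] is therefore split among the
    pairs [(X i, Y j)] with weights [k i (S y) * l j y], the conditional probabilities of the
    indices in the two couplings. The obstacle is the boundary of [Omega]: at a contact point there
    the gradient of the gap may point inwards, and the gap then grows linearly. Such points are null
    for [mu] because [mu] has a density, and the transport identity carries this to [nu] through
    [S]. Smoothness is available for [phi0] alone; [psi0] is controlled through its contact points.
    The constant is [expR M * (K + L ^+ 2)], with [K] equal to half of [1 + kappa^-1], [M] a bound
    of both potentials and [L] a Lipschitz constant of their exponentials. *)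

Section dot_product.
Context {R : realType} {d : nat}.
Implicit Types (x y u v : 'rV[R]_d).

Lemma dotvC u v : dotv u v = dotv v u.
Proof. by apply: eq_bigr => i _; rewrite mulrC. Qed.

Lemma dotvDl u v w : dotv (u + v) w = dotv u w + dotv v w.
Proof. by rewrite -big_split; apply: eq_bigr => i _; rewrite mxE mulrDl. Qed.

Lemma dotvZl a u v : dotv (a *: u) v = a * dotv u v.
Proof. by rewrite mulr_sumr; apply: eq_bigr => i _; rewrite mxE mulrA. Qed.

Lemma dotvNl u v : dotv (- u) v = - dotv u v.
Proof. by rewrite -scaleN1r dotvZl mulN1r. Qed.

Lemma dotvDr u v w : dotv u (v + w) = dotv u v + dotv u w.
Proof. by rewrite dotvC dotvDl (dotvC v) (dotvC w). Qed.

Lemma dotvZr a u v : dotv u (a *: v) = a * dotv u v.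
Proof. by rewrite dotvC dotvZl dotvC. Qed.

Lemma dotvNr u v : dotv u (- v) = - dotv u v.
Proof. by rewrite dotvC dotvNl dotvC. Qed.

Definition dotvE := (dotvDl, dotvDr, dotvNl, dotvNr, dotvZl, dotvZr).

Lemma dotv_ge0 u : 0 <= dotv u u.
Proof. by apply: sumr_ge0 => i _; rewrite -expr2 sqr_ge0. Qed.

Lemma sqr_norm2 u : norm2 u ^+ 2 = dotv u u.
Proof. by rewrite sqr_sqrtr// dotv_ge0. Qed.

Lemma norm2_ge0 u : 0 <= norm2 u.
Proof. exact: sqrtr_ge0. Qed.

Lemma dotv_young a u v : 0 < a ->
  dotv u v <= a / 2 * dotv u u + (2 * a)^-1 * dotv v v.
Proof.
move=> a0; have := dotv_ge0 (a *: u - v); rewrite !dotvE (dotvC v u).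
set p := dotv u u; set q := dotv u v; set r := dotv v v => H.
rewrite -subr_ge0 (_ : _ - q = (2 * a)^-1 * (a * (a * p) + - (a * q) + (a * - q - - r))).
  by rewrite mulr_ge0//; [rewrite invr_ge0|]; lra.
by field; lra.
Qed.

(** Young's inequality with the optimal parameter [norm2 v / norm2 u]. If a norm vanishes, a
    positive [dotv u v] is refuted by a parameter that makes the surviving term at most
    [dotv u v]. *)
Lemma dotv_le_norm2 u v : dotv u v <= norm2 u * norm2 v.
Proof.
have H a : 0 < a -> 2 * dotv u v <= a * norm2 u ^+ 2 + a^-1 * norm2 v ^+ 2.
  move=> a0; have := dotv_young u v a0; rewrite !sqr_norm2 invfM; lra.
have [u0|u0] := eqVneq (norm2 u) 0; last have [v0|v0] := eqVneq (norm2 v) 0.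
- rewrite u0 mul0r leNgt; apply/negP => p0.
  have q0 := sqr_ge0 (norm2 v).
  have b0 : 0 < (norm2 v ^+ 2 + 1) / dotv u v by apply: divr_gt0; lra.
  have := H _ b0; rewrite u0 expr0n mulr0 add0r invfM invrK => {}H.
  have : (norm2 v ^+ 2 + 1)^-1 * (norm2 v ^+ 2) <= 1.
    by rewrite mulrC ler_pdivrMr; lra.
  nra.
- rewrite v0 mulr0 leNgt; apply/negP => p0.
  have q0 := sqr_ge0 (norm2 u).
  have b0 : 0 < dotv u v / (norm2 u ^+ 2 + 1) by apply: divr_gt0; lra.
  have := H _ b0; rewrite v0 expr0n mulr0 addr0 => {}H.
  have : (norm2 u ^+ 2 + 1)^-1 * (norm2 u ^+ 2) <= 1.
    by rewrite mulrC ler_pdivrMr; lra.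
  nra.
- have u1 : 0 < norm2 u by rewrite lt_neqAle eq_sym u0 norm2_ge0.
  have v1 : 0 < norm2 v by rewrite lt_neqAle eq_sym v0 norm2_ge0.
  have := H _ (divr_gt0 v1 u1).
  rewrite (_ : _ + _ = 2 * (norm2 u * norm2 v)); first lra.
  by field; rewrite u0 v0.
Qed.

Lemma norm2D u v : norm2 (u + v) <= norm2 u + norm2 v.
Proof.
rewrite -(ler_pXn2r (n := 2)) ?nnegrE ?addr_ge0 ?norm2_ge0//.
rewrite sqr_norm2 !dotvE (dotvC v u) sqrrD -!sqr_norm2.
have := dotv_le_norm2 u v; rewrite -mulr_natr; lra.
Qed.

Lemma norm2N u : norm2 (- u) = norm2 u.
Proof. by rewrite /norm2 dotvNl dotvNr opprK. Qed.

Lemma norm2_distC u v : norm2 (u - v) = norm2 (v - u).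
Proof. by rewrite -norm2N opprB. Qed.

Lemma coord_le_norm2 u i : `|u 0 i| <= norm2 u.
Proof.
rewrite -sqrtr_sqr ler_sqrt ?dotv_ge0// /dotv (bigD1 i)//= expr2 lerDl.
by apply: sumr_ge0 => j _; rewrite -expr2 sqr_ge0.
Qed.

Lemma coord_le_mx_norm u i : `|u 0 i| <= `|u|.
Proof.
by rewrite [leRHS]/Num.norm/= mx_normrE; apply/bigmax_geP; right; exists (0, i).
Qed.

Lemma mx_norm_le u (e : R) : 0 <= e -> (forall i, `|u 0 i| <= e) -> `|u| <= e.
Proof.
move=> e0 ue; rewrite [leLHS]/Num.norm/= mx_normrE; apply/bigmax_leP; split => //.
by move=> [i j] _ /=; rewrite ord1.
Qed.

Lemma mx_norm_le_norm2 u : `|u| <= norm2 u.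
Proof. by apply: mx_norm_le; [exact: norm2_ge0|exact: coord_le_norm2]. Qed.

Lemma abs_dotv_le u v : `|dotv u v| <= d%:R * (`|u| * `|v|).
Proof.
rewrite (le_trans (ler_norm_sum _ _ _))// mulr_natl.
rewrite -[X in _ *+ X]card_ord -sumr_const; apply: ler_sum => i _.
by rewrite normrM ler_pM// coord_le_mx_norm.
Qed.

Lemma norm2_le_mx_norm u : norm2 u <= d%:R * `|u|.
Proof.
rewrite -(ler_pXn2r (n := 2)) ?nnegrE ?mulr_ge0 ?norm2_ge0//.
rewrite sqr_norm2 (le_trans (ler_norm _))// (le_trans (abs_dotv_le _ _))//.
rewrite exprMn -expr2 ler_wpM2r ?sqr_ge0//.
by rewrite -natrX ler_nat; case: (d) => // k; rewrite expnS expn1 leq_pmulr.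
Qed.

End dot_product.

(** * Second-order Taylor bounds relative to a convex domain *)

Section taylor.
Context {R : realType} {d : nat}.
Local Notation E := 'rV[R]_d.
Variable Omega : set E.
Hypothesis cvxO : convex_set (Omega : set (convex_lmodType E)).

Lemma convex_segment x y t : Omega x -> Omega y -> 0 <= t <= 1 ->
  Omega (x + t *: (y - x)).
Proof.
move=> Ox Oy /andP[t0 t1].
have t01 : Itv.spec (@Itv.num_sem R) (Itv.Real `[0, 1]%Z) t.
  by apply/and3P; split; rewrite ?bnd_simp ?ger0_real.
have := cvxO (Itv.mk t01) (mem_set Oy) (mem_set Ox); rewrite inE.
by rewrite /conv/= scalerBl scale1r addrCA scalerBr.
Qed.

Let seg (x v : E) (t : R) : E := x + t *: v.

Let seg_sub x v t s : seg x v t - seg x v s = (t - s) *: v.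
Proof. by rewrite /seg opprD addrACA subrr add0r scalerBl. Qed.

(* A first-order expansion of [f] relative to [Omega] yields the derivative of
   [f] along the segments of [Omega]. *)
Let seg_expansion (f : E -> R) (l x v : E) (t : R) :
  Omega x -> Omega (x + v) -> 0 <= t <= 1 ->
  (fun y => f y - f (seg x v t) - dotv l (y - seg x v t) : R^o)
      =o_ (within Omega (nbhs (seg x v t))) (fun y => y - seg x v t) ->
  forall e : R, 0 < e -> exists2 r : R, 0 < r & forall s, 0 <= s <= 1 ->
    `|s - t| < r ->
    `|f (seg x v s) - f (seg x v t) - dotv l v * (s - t)| <= e * `|s - t|.
Proof.
move=> Ox Oxv t01 /eqoP fo e e0.
have v0 : 0 < `|v| + 1 by rewrite ltr_wpDl.
have /= := fo (e / (`|v| + 1)) (divr_gt0 e0 v0).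
move=> /nbhs_ballP[r /= r0 rP].
exists (r / (`|v| + 1)); first exact: divr_gt0.
move=> s s01 st; have /= := rP (seg x v s); rewrite seg_sub normrZ dotvZr.
rewrite (mulrC (dotv l v)) => /(_ _ _)/le_trans; apply.
- rewrite -ball_normE /= distrC seg_sub normrZ.
  rewrite ltr_pdivlMr// in st; apply: le_lt_trans st.
  by rewrite ler_wpM2l// lerDl.
- have := convex_segment Ox Oxv s01; rewrite addrAC subrr add0r; exact.
- rewrite mulrAC ler_pdivrMr// mulrA ler_wpM2l ?mulr_ge0 ?(ltW e0)//.
  by rewrite lerDl.
Qed.

(** At an interior [t] the expansion relative to the unit interval is two-sided once the increment
    is shorter than [t] and [1 - t]. *)
Let expansion_derive (a : R -> R) (l t : R) : 0 < t < 1 ->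
  (forall e : R, 0 < e -> exists2 r : R, 0 < r & forall s, 0 <= s <= 1 ->
    `|s - t| < r -> `|a s - a t - l * (s - t)| <= e * `|s - t|) ->
  is_derive t 1 a l.
Proof.
move=> /andP[t0 t1] H.
suff cl : h^-1 *: (a (h *: (1:R) + t) - a t) @[h --> 0^'] --> l.
  by split; [apply: cvgP; exact: cl|exact: (cvg_lim _ cl)].
apply/cvgrPdist_le => /= e e0; have [r r0 rP] := H _ e0.
near=> h; have h0 : h != 0 by near: h; exact: nbhs_dnbhs_neq.
have hr : `|h| < Num.min r (Num.min t (1 - t)).
  near: h; apply: dnbhs0_lt; rewrite !lt_min r0 t0/=; lra.
move: hr; rewrite !lt_min => /and3P[hr ht h1].
have := rP (h + t); rewrite addrK => /(_ _ hr) {}rP.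
have : 0 <= h + t <= 1 by move: ht h1; rewrite !ltr_norml => /andP[? ?] /andP[? ?]; lra.
move=> /rP {}rP.
rewrite -(ler_pM2r (x := `|h|)) ?normr_gt0// (le_trans _ rP)//.
rewrite -normrM distrC /GRing.scale/= mulr1.
rewrite mulrBl mulrAC mulVf// mul1r; by rewrite lexx.
Unshelve. all: by end_near. Qed.

(** At the end points the expansion is one-sided and yields only continuity, which is all that the
    mean value theorem asks there. *)
Let expansion_continuous (a : R -> R) (l : R -> R) :
  (forall t, 0 <= t <= 1 ->
  (forall e : R, 0 < e -> exists2 r : R, 0 < r & forall s, 0 <= s <= 1 ->
    `|s - t| < r -> `|a s - a t - l t * (s - t)| <= e * `|s - t|)) ->
  {within `[0, 1], continuous a}.
Proof.
move=> H; apply/subspace_continuousP => t; rewrite /= in_itv/= => t01.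
apply/cvgrPdist_le => /= e e0; have [r r0 rP] := H _ t01 1 ltr01.
have l1 : 0 < 1 + `|l t| by rewrite ltr_pwDl.
rewrite near_withinE; near=> s => /=; rewrite in_itv/= => s01.
have sr : `|s - t| < Num.min r (e / (1 + `|l t|)).
  rewrite distrC; near: s; apply: nbhsx_ballx.
  by rewrite lt_min r0 divr_gt0.
move: sr; rewrite lt_min ltr_pdivlMr// => /andP[sr se].
rewrite distrC (le_trans _ (ltW se))//.
rewrite -[a s - a t](subrK (l t * (s - t))) (le_trans (ler_normD _ _))//.
by rewrite [leRHS]mulrDr normrM (mulrC `|l t|) lerD2r mulr1 (le_trans (rP _ s01 sr))// mul1r.
Unshelve. all: by end_near. Qed.

Let loewner_scalar v (a : R) (A : 'M[R]_d) :
  loewner_le A a%:M -> dotv (v *m A) v <= a * dotv v v.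
Proof.
move=> /(_ v); rewrite mulmxBr mul_mx_scalar !dotvE; lra.
Qed.

Let scalar_loewner v (a : R) (A : 'M[R]_d) :
  loewner_le a%:M A -> a * dotv v v <= dotv (v *m A) v.
Proof.
move=> /(_ v); rewrite mulmxBr mul_mx_scalar !dotvE; lra.
Qed.

(** The Hessian is not assumed continuous, so the remainder is not written as an integral. Along the
    segment [b] is the derivative of [a], and [c] that of [b]: one mean value argument bounds
    [b t - b 0], and a second one treats [a] minus its linear part and a parabola. *)
Lemma taylor_bounds phi g H (k1 k2 : R) :
  gradient_on Omega phi g ->
  (forall x, Omega x -> (fun y => g y - g x - (y - x) *m H x)
        =o_ (within Omega (nbhs x)) (fun y => y - x)) ->
  (forall x, Omega x -> loewner_le k1%:M (H x) /\ loewner_le (H x) k2%:M) ->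
  forall x y, Omega x -> Omega y ->
    k1 / 2 * dotv (y - x) (y - x) <= phi y - phi x - dotv (g x) (y - x)
      <= k2 / 2 * dotv (y - x) (y - x).
Proof.
move=> gP HP Hk x y Ox Oy; set v := y - x.
have yE : y = x + v by rewrite /v addrC subrK.
have Oxv : Omega (x + v) by rewrite -yE.
have Os t : 0 <= t <= 1 -> Omega (seg x v t).
  by move=> t01; exact: convex_segment.
pose a t := phi (seg x v t); pose b t := dotv (g (seg x v t)) v.
pose c t := dotv (v *m H (seg x v t)) v.
have aE t : 0 <= t <= 1 -> _ := fun t01 => seg_expansion Ox Oxv t01 (gP _ (Os t t01)).
have bE t : 0 <= t <= 1 -> forall e : R, 0 < e -> exists2 r : R, 0 < r & forall s, 0 <= s <= 1 ->
    `|s - t| < r -> `|b s - b t - c t * (s - t)| <= e * `|s - t|.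
  move=> t01 e e0; have /eqoP Ho := HP _ (Os t t01).
  have v0 : 0 < d%:R * (`|v| * `|v|) + 1 by rewrite ltr_wpDl ?mulr_ge0.
  have v1 : 0 < `|v| + 1 by rewrite ltr_wpDl.
  have /= := Ho (e / (d%:R * (`|v| * `|v|) + 1)) (divr_gt0 e0 v0).
  move=> /nbhs_ballP[r /= r0 rP].
  exists (r / (`|v| + 1)); first exact: divr_gt0.
  move=> s s01 st; have /= := rP (seg x v s); rewrite seg_sub normrZ.
  move=> /(_ _ _) {}rP.
  have -> : b s - b t - c t * (s - t) =
    dotv (g (seg x v s) - g (seg x v t) - (s - t) *: v *m H (seg x v t)) v.
    by rewrite /b /c -scalemxAl !dotvE; ring.
  apply: (le_trans (abs_dotv_le _ _)).
  apply: (@le_trans _ _ (d%:R * (e / (d%:R * (`|v| * `|v|) + 1) * (`|s - t| * `|v|) * `|v|))).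
    rewrite ler_wpM2l// ler_wpM2r// rP//.
      rewrite -ball_normE /= distrC seg_sub normrZ.
      rewrite ltr_pdivlMr// in st; apply: le_lt_trans st.
      by rewrite ler_wpM2l// lerDl.
    by have := Os _ s01.
  rewrite (_ : _ * _ = e * `|s - t| * ((d%:R * (`|v| * `|v|)) / (d%:R * (`|v| * `|v|) + 1))); last first.
    by field; rewrite gt_eqF.
  rewrite ler_piMr ?mulr_ge0 ?(ltW e0)//.
  by rewrite ler_pdivrMr// mul1r lerDl.
have bB t : 0 <= t <= 1 -> k1 * dotv v v * t <= b t - b 0 <= k2 * dotv v v * t.
  move=> /andP[t0 t1].
  have [s||s] := @MVT_segment R b c 0 t t0.
  - rewrite in_itv/= => /andP[s0 st].
    by apply: expansion_derive; [lra|apply: bE; lra].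
  - apply: (continuous_subspaceW _ (expansion_continuous bE)).
    by move=> z /=; rewrite !in_itv/=; lra.
  rewrite in_itv/= => /andP[s0 st]; rewrite subr0 => ->.
  have [|/(scalar_loewner v) h1 /(loewner_scalar v) h2] := Hk (seg x v s).
    by apply: Os; lra.
  by rewrite !ler_wpM2r.
(* With [k] equal to [k1 / 2 * dotv v v] or [k2 / 2 * dotv v v], the estimate [bB] gives the sign of
   this derivative, and the increment over the unit interval is the difference of the two sides of
   the claim. *)
have rB (k t : R) : 0 < t < 1 ->
    is_derive t 1 (fun s => a s - b 0 * s - k * s ^+ 2) (b t - b 0 - k * (2 * t)).
  move=> t01; have ad : is_derive t 1 a (b t).
    by apply: expansion_derive => //; apply: aE; lra.
  clearbody a; apply: is_derive_eq.
  rewrite /GRing.scale/= !mulr1.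
  ring.
have rC (k : R) : {within `[0, 1], continuous (fun s => a s - b 0 * s - k * s ^+ 2)}.
  have aC := expansion_continuous aE.
  move=> z; apply: cvgB; first apply: cvgB; first exact: aC.
    apply: continuous_subspaceT => {}z; apply: cvgM; [exact: cvg_cst|exact: cvg_id].
  have kC : continuous (fun s : R => k * s ^+ 2).
    by move=> s; apply: cvgM; [exact: cvg_cst|exact: exprn_continuous].
  exact: (continuous_subspaceT kC).
have rM (k : R) : exists2 s, 0 <= s <= 1 & phi y - phi x - dotv (g x) v - k =
    b s - b 0 - k * (2 * s).
  have rD s : s \in `]0, 1[ -> _ := fun s01 => rB k s s01.
  have [s] := MVT ltr01 rD (rC k).
  rewrite in_itv/= => /andP[s0 s1] sE; exists s; first lra.
  have a0 : a 0 = phi x by rewrite /a /seg scale0r addr0.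
  have a1 : a 1 = phi y by rewrite /a /seg scale1r -yE.
  have b0 : b 0 = dotv (g x) v by rewrite /b /seg scale0r addr0.
  move: sE; rewrite a0 a1 b0; lra.
apply/andP; split.
- have [s s01] := rM (k1 / 2 * dotv v v); have := bB _ s01; nra.
- have [s s01] := rM (k2 / 2 * dotv v v); have := bB _ s01; nra.
Qed.

End taylor.

(** * Contact points and the gap of conjugate potentials *)

Section potentials.
Context {R : realType} {d : nat}.
Local Notation E := 'rV[R]_d.
Implicit Types (Omega : set E) (phi psi : E -> R) (x y : E).

Definition cost x y : R := 2^-1 * norm2 (x - y) ^+ 2.

Lemma costE x y : cost x y = 2^-1 * dotv (x - y) (x - y).
Proof. by rewrite /cost sqr_norm2. Qed.

Lemma cost_ge0 x y : 0 <= cost x y.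
Proof. by rewrite mulr_ge0// sqr_ge0. Qed.

Lemma costC x y : cost x y = cost y x.
Proof. by rewrite /cost norm2_distC. Qed.

Lemma cost_continuous y : continuous (fun x => cost x y).
Proof.
have c i : continuous (fun z : E => z 0 i - y 0 i).
  by move=> z; apply: continuousB; [exact: coord_continuous|exact: cst_continuous].
move=> x; rewrite (_ : (fun _ => _) = fun z : E =>
    2^-1 * \sum_(i < d) (z 0 i - y 0 i) * (z 0 i - y 0 i)); last first.
  by apply/funext => z; rewrite costE /dotv; under eq_bigr do rewrite !mxE.
have s : continuous (fun z : E => \sum_(i < d) (z 0 i - y 0 i) * (z 0 i - y 0 i)).
  apply: (@continuous_big R) => [|i _]; first exact: add_continuous.
  by move=> z; exact: (continuousM (c i z) (c i z)).
exact: (continuousM (@cst_continuous E R (2^-1 : R) x) (s x)).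
Qed.

Lemma compact_norm2_bounded Omega : compact Omega ->
  exists2 D : R, 0 < D & forall x y, Omega x -> Omega y -> norm2 (x - y) <= D.
Proof.
move=> /compact_bounded/ex_strict_bound_gt0[M M0 OM].
exists (d%:R * (M + M) + 1); first by rewrite ltr_wpDl// mulr_ge0// addr_ge0// ltW.
move=> x y Ox Oy; rewrite (le_trans (norm2_le_mx_norm _))//.
rewrite ler_wpDr// ler_wpM2l// (le_trans (ler_normB _ _))//.
by rewrite lerD// ltW//; apply: OM.
Qed.

(** The difference of the costs is half the inner product of [x - x'] with [(x - y) + (x' - y)],
    whose norm is at most [2 * D]. *)
Lemma cost_lipschitz x x' y (D : R) : norm2 (x - y) <= D -> norm2 (x' - y) <= D ->
  cost x y <= cost x' y + D * norm2 (x - x').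
Proof.
move=> xD x'D; rewrite !costE.
have H := dotv_le_norm2 (x - x') ((x - y) + (x' - y)).
have H2 := norm2D (x - y) (x' - y).
have n0 := norm2_ge0 (x - x').
have {H} : dotv (x - x') (x - y + (x' - y)) <= norm2 (x - x') * (D + D).
  by apply: (le_trans H); rewrite ler_wpM2l//; lra.
rewrite (_ : x' - y = (x - y) - (x - x')); last first.
  by rewrite opprB [RHS]addrC subrKA.
move: (x - y) (x - x') => u v; rewrite !dotvE (dotvC v u); lra.
Qed.

(** An infimum of functions that are [D]-Lipschitz in [x] is [D]-Lipschitz. As [chi] may take
    infinite values, the last step distinguishes cases. *)
Lemma c_concave_lipschitz Omega phi (D : R) :
  (forall x y, Omega x -> Omega y -> norm2 (x - y) <= D) ->
  c_concave Omega phi ->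
  forall x x', Omega x -> Omega x' -> `|phi x - phi x'| <= D * norm2 (x - x').
Proof.
move=> OD [chi chiE].
suff H x x' : Omega x -> Omega x' -> phi x - D * norm2 (x - x') <= phi x'.
  move=> x x' Ox Ox'; rewrite ler_distlC; apply/andP; split.
    rewrite lerBlDr -lerBlDl; have := H _ _ Ox Ox'; lra.
  have := H _ _ Ox' Ox; rewrite norm2_distC; lra.
move=> Ox Ox'; rewrite -lee_fin (chiE _ Ox') le_ereal_inf_tmp//.
move=> _ [y Oy <-]; rewrite EFinB leeBlDr// (chiE _ Ox).
apply: (@le_trans _ _ ((2^-1 * norm2 (x - y) ^+ 2)%:E - chi y)%E).
  by apply: ereal_inf_lbound; exists y.
have := cost_lipschitz (OD _ _ Ox Oy) (OD _ _ Ox' Oy).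
rewrite /cost; case: (chi y) => [r| |] /=; rewrite ?lee_fin//; lra.
Qed.

(** A substitute for the topological interior: stationarity along the axes already determines a
    gradient, and the points of a closed convex set that fail this condition are null by slicing
    along the axes. *)
Definition axis_interior Omega x := forall i : 'I_d, exists2 e : R, 0 < e &
  Omega (x + e *: delta_mx 0 i) /\ Omega (x - e *: delta_mx 0 i).

Lemma dotv_delta (u : E) i : dotv u (delta_mx 0 i) = u 0 i.
Proof.
rewrite /dotv (bigD1 i)//= mxE !eqxx mulr1 big1 ?addr0// => j ji.
by rewrite mxE eqxx/= (negbTE ji) mulr0.
Qed.

Section c_conjugate.
Variables (Omega : set E) (phi psi : E -> R) (g : E -> E) (k : R).
Hypothesis cO : compact Omega.
Hypothesis O0 : Omega !=set0.
Hypothesis cvxO : convex_set (Omega : set (convex_lmodType E)).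
Hypothesis k01 : 0 < k < 1.
Hypothesis cphi : {within Omega, continuous phi}.
Hypothesis psiE : forall y, Omega y ->
  (psi y)%:E = c_transform Omega (EFin \o phi) y.
Hypothesis taylor : forall x y, Omega x -> Omega y ->
    (1 - k^-1) / 2 * dotv (y - x) (y - x) <= phi y - phi x - dotv (g x) (y - x)
      <= (1 - k) / 2 * dotv (y - x) (y - x).

Lemma c_transform_le x y : Omega x -> Omega y -> psi y <= cost x y - phi x.
Proof.
move=> Ox Oy; rewrite -lee_fin (psiE Oy); apply: ereal_inf_lbound.
by exists x => //=; rewrite -EFinB -/(cost y x) costC.
Qed.

Lemma c_transform_attained y : Omega y ->
  exists2 x, Omega x & psi y = cost x y - phi x.
Proof.
move=> Oy; have [|x Ox xmin] := @compact_EVT_min _ R (fun x => cost x y - phi x) _ O0 cO.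
  move=> x; apply: cvgB; last exact: cphi.
  exact: (continuous_subspaceT (@cost_continuous y)).
exists x; first by rewrite inE in Ox.
apply/eqP; rewrite eq_le c_transform_le//=; last by rewrite inE in Ox.
rewrite -lee_fin (psiE Oy) le_ereal_inf_tmp// => _ [z Oz <-] /=.
by rewrite -EFinB lee_fin -/(cost y z) (costC y) xmin ?inE.
Qed.

Let nonneg_slope (a b : R) : (forall t, 0 < t < 1 -> 0 <= t * a + t ^+ 2 * b) -> 0 <= a.
Proof.
move=> H; rewrite leNgt; apply/negP => a0.
have b0 : 0 < `|b| + 1 by rewrite ltr_wpDl.
(* So small that the quadratic term is at most half the size of the negative linear one. *)
pose t := Num.min (1 / 2) (- a / (2 * (`|b| + 1))).
have t0 : 0 < t by rewrite lt_min divr_gt0//= divr_gt0//; lra.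
have t1 : t <= 1 / 2 by rewrite /t ge_min lexx.
have ta : t * (`|b| + 1) <= - a / 2.
  apply: (@le_trans _ _ (- a / (2 * (`|b| + 1)) * (`|b| + 1))).
    by rewrite ler_wpM2r ?(ltW b0)// /t ge_min lexx orbT.
  by rewrite le_eqVlt; apply/orP; left; apply/eqP; field; rewrite gt_eqF.
have : 0 <= t * a + t ^+ 2 * b by apply: H; lra.
have := ler_norm b; nra.
Qed.

(** The variational inequality of constrained minimisation: [x] minimises [cost x y - phi x] over
    the convex [Omega], and [x - y - g x] is the gradient of that function at [x]. *)
Lemma argmin_first_order x y z : Omega x -> Omega y -> Omega z ->
  psi y = cost x y - phi x -> 0 <= dotv (x - y - g x) (z - x).
Proof.
move=> Ox Oy Oz pE; apply: (nonneg_slope (b := dotv (z - x) (z - x) * (k^-1 / 2))).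
move=> t t01; have Oxt : Omega (x + t *: (z - x)).
  by apply: convex_segment => //; lra.
have := c_transform_le Oxt Oy; have := taylor Ox Oxt.
rewrite pE !costE (addrC x (t *: _)) addrK -[t *: (z - x) + x - y]addrA.
move: (z - x) (x - y) => v u; rewrite !dotvE (dotvC v u).
move: (dotv v v) (dotv u v) (dotv (g x) v) (dotv u u) => vv uv gv uu.
move=> /andP[+ _]; lra.
Qed.

(** The cost has Hessian 1 in its first variable and [phi] at most [1 - k], so their difference is
    strongly convex with modulus [k]; at the minimiser its first-order term has the right sign. *)
Lemma gap_ge x y z : Omega x -> Omega y -> Omega z ->
  psi y = cost x y - phi x ->
  k / 2 * dotv (z - x) (z - x) <= cost z y - phi z - psi y.
Proof.
move=> Ox Oy Oz pE; have := argmin_first_order Ox Oy Oz pE.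
have := taylor Ox Oz; rewrite pE !costE.
rewrite (_ : z - y = (z - x) + (x - y)); last by rewrite addrA subrK.
move: (z - x) (x - y) => v u; rewrite !dotvE (dotvC v u).
move: (dotv v v) (dotv u v) (dotv (g x) v) (dotv u u) => vv uv gv uu.
by move=> /andP[_ +]; lra.
Qed.

(** Adding [gap_ge] at the two contact points cancels [phi] and leaves [k * dotv (x - x') (x - x')
    <= dotv (x - x') (y - y')]. Uniqueness of the contact point is the case [y = y']. *)
Lemma argmin_lipschitz x y x' y' : Omega x -> Omega y -> Omega x' -> Omega y' ->
  psi y = cost x y - phi x -> psi y' = cost x' y' - phi x' ->
  k * norm2 (x - x') <= norm2 (y - y').
Proof.
move=> Ox Oy Ox' Oy' pE pE'.
have := gap_ge Ox Oy Ox' pE; have := gap_ge Ox' Oy' Ox pE'.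
rewrite pE pE' !costE => h1 h2.
have : k * dotv (x - x') (x - x') <= dotv (x - x') (y - y').
  move: h1 h2; rewrite !dotvE ?(dotvC x' x) ?(dotvC y x) ?(dotvC y' x) ?(dotvC y x')
    ?(dotvC y' x') ?(dotvC y' y).
  lra.
rewrite -sqr_norm2 => h; have := le_trans h (dotv_le_norm2 _ _).
have [->|n0] := eqVneq (norm2 (x - x')) 0; first by rewrite mulr0 norm2_ge0.
rewrite expr2 mulrCA ler_pM2l//.
by rewrite lt_neqAle eq_sym n0 norm2_ge0.
Qed.

(** The variational inequality, tested at two opposite points of axis [i], gives both signs for
    coordinate [i] of [x - y - g x]. *)
Lemma axis_interior_gradient x y : axis_interior Omega x -> Omega x -> Omega y ->
  psi y = cost x y - phi x -> g x = x - y.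
Proof.
move=> ix Ox Oy pE; apply/rowP => i; have [e e0 [Op Om]] := ix i.
have := argmin_first_order Ox Oy Op pE; have := argmin_first_order Ox Oy Om pE.
rewrite !(addrC x) !addrK dotvNr dotvZr dotv_delta.
rewrite !oppr_ge0 pmulr_rle0// pmulr_rge0//.
set w := _ - g x => w1 w2; have : w 0 i = 0 by apply/eqP; rewrite eq_le w1.
by rewrite !mxE (addrC (- y 0 i)) => /eqP; rewrite subr_eq0 => /eqP.
Qed.

(* At an axis-interior minimiser [x] the gradient of [phi] is [x - y], so that the
   gap vanishes to second order at [(x, y)]. *)
Lemma gap_le x y z w : axis_interior Omega x -> Omega x -> Omega y ->
  Omega z -> Omega w -> psi y = cost x y - phi x ->
  cost z w - phi z - psi w <=
    (1 + k^-1) / 2 * (dotv (z - x) (z - x) + dotv (w - y) (w - y)).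
Proof.
move=> ix Ox Oy Oz Ow pE; have gE := axis_interior_gradient ix Ox Oy pE.
(* [psi w] is bounded below through its own contact point [x']. The growth [h1] of the gap at [x']
   absorbs, by Young's inequality [h2], the cross term between [x' - x] and [w - y]; the lower
   Hessian bound enters in [h3] only. *)
have [x' Ox' pE'] := c_transform_attained Ow.
have h1 := gap_ge Ox Oy Ox' pE.
have [/andP[k0 k1]] := k01.
have h2 := dotv_young (x' - x) (w - y) k0.
have /andP[h3 _] := taylor Ox Oz.
have h4 := dotv_ge0 ((z - x) + (w - y)).
rewrite invfM in h2; move: h1 h2 h3 h4; rewrite gE pE' pE !costE.
rewrite !dotvE ?(dotvC x' x) ?(dotvC y x) ?(dotvC z x) ?(dotvC w x) ?(dotvC y x')
  ?(dotvC z x') ?(dotvC w x') ?(dotvC z y) ?(dotvC w y) ?(dotvC w z).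
lra.
Qed.

End c_conjugate.
End potentials.

(** * Null sets of Lebesgue measure on row vectors *)

Section lebesgue_null.
Context {R : realType}.
Local Open Scope ereal_scope.

Lemma measurable_open_rV d (U : set 'rV[R]_d) : open U -> measurable U.
Proof. exact: sub_sigma_algebra. Qed.

Lemma measurable_closed_rV d (F : set 'rV[R]_d) : closed F -> measurable F.
Proof.
by move=> cF; rewrite -[F]setCK; apply: measurableC; apply: measurable_open_rV; rewrite openC.
Qed.

Lemma measurable_set1_rV d (a : 'rV[R]_d) : measurable [set a].
Proof.
apply: measurable_closed_rV; apply: accessible_closed_set1.
exact/hausdorff_accessible/norm_hausdorff.
Qed.

Lemma lebesgue_rVS d (A : set 'rV[R]_d.+1) :
  lebesgue_rV A = (lebesgue_measure \x^ @lebesgue_rV R d) (@cons_rV R d @^-1` A).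
Proof. by []. Qed.

Lemma lebesgue_rV_ball_fin d (k : nat) :
  lebesgue_rV (ball (0%R : 'rV[R]_d) k.+1%:R) < +oo.
Proof.
elim: d => [|d IH].
  by rewrite /= (le_lt_trans (probability_le1 _ _))// ?ltry//; apply: measurable_open_rV; exact: ball_open.
rewrite lebesgue_rVS.
rewrite (_ : _ @^-1` _ = (ball (0%R : R) k.+1%:R) `*` (ball (0%R : 'rV[R]_d) k.+1%:R)); last first.
  apply/seteqP; split => [[z v] [_ H]|[z v] [/= zk [_ vk]]] /=.
    split => /=.
      by have := H 0%R ord0; rewrite /ball/= !mxE unlift_none.
    split=> // i j; have := H 0%R (lift ord0 j).
    by rewrite /ball/= !mxE liftK ord1.
  split=> // i j; rewrite ord1 /ball/= !mxE; case: unliftP => [j' _|_].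
    by have := vk 0%R j'; rewrite /ball/= !mxE.
  exact: zk.
rewrite product_measure2E//; last 2 first.
- exact: measurable_ball.
- by apply: measurable_open_rV; exact: ball_open.
rewrite lte_mul_pinfty//.
- change (lebesgue_measure (ball (0%R : R) k.+1%:R) \is a fin_num).
  by rewrite lebesgue_measure_ball.
Qed.

Lemma lebesgue_rV_sigma_finite d : sigma_finite setT (@lebesgue_rV R d).
Proof.
exists (fun k => ball (0%R : 'rV[R]_d) k.+1%:R); last first.
  move=> k; split; first by apply: measurable_open_rV; exact: ball_open.
  exact: lebesgue_rV_ball_fin.
apply/esym/seteqP; split => // x _.
have [k xk] : exists k : nat, (`|x| < k%:R)%R.
  by exists (Num.truncn `|x|%R).+1; rewrite truncnS_gt.
exists k => //; rewrite -ball_normE /= sub0r normrN (lt_le_trans xk)//.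
by rewrite ler_nat.
Qed.

HB.instance Definition _ d := Measure_isSigmaFinite.Build _ _ _
  (@lebesgue_rV R d) (@lebesgue_rV_sigma_finite d).

(** The definition slices by lines along the first axis. Sigma-finiteness permits the other order,
    slicing by hyperplanes of constant first coordinate, on which one can induct over the
    dimension. *)
Lemma lebesgue_rVS1 d (A : set 'rV[R]_d.+1) : measurable A ->
  lebesgue_rV A = (lebesgue_measure \x @lebesgue_rV R d) (@cons_rV R d @^-1` A).
Proof.
move=> mA; rewrite lebesgue_rVS.
apply/esym; apply: product_measure_unique => [B C mB mC|].
  by apply: product_measure2E.
by rewrite -[X in measurable X]setTI; exact: measurable_cons_rV.
Qed.

(** Each line parallel to axis [i] meets [A] at most once. For the first axis the line sections are
    thus null; for another axis, freezing the first coordinate lowers the dimension. *)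
Lemma lebesgue_rV_transversal d (i : 'I_d) (A : set 'rV[R]_d) : measurable A ->
  (forall x t, t != 0%R -> A x -> ~ A (x + t *: delta_mx 0 i)%R) ->
  lebesgue_rV A = 0.
Proof.
elim: d i A => [[]//|d IH] i A mA AP.
have mpA : measurable (@cons_rV R d @^-1` A).
  by rewrite -[X in measurable X]setTI; exact: measurable_cons_rV.
have [j ij|i0] := unliftP ord0 i; last first.
  rewrite lebesgue_rVS; apply: integral0_eq => v _ /=.
  have [[s As]|nA] := pselect (exists s, ysection (cons_rV (d := d) @^-1` A) v s).
    rewrite (_ : ysection _ _ = [set s]) ?lebesgue_measure_set1//.
    apply/seteqP; split => [t At|_ -> //]; apply: contrapT => /= ts.
    move: As At; rewrite /ysection/= !inE/= => As.
    have := AP (cons_rV (s, v)) (t - s)%R; rewrite subr_eq0 => /(_ _ As) H At.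
    apply: H; first exact/eqP.
    congr A : At; apply/rowP => k; rewrite i0 !mxE.
    case: unliftP => [k' ->|->] /=.
      by rewrite mulr0 addr0.
    by rewrite mulr1 addrC subrK.
  rewrite (_ : ysection _ _ = set0) ?measure0//.
  by apply/seteqP; split => // t At; apply: nA; exists t.
rewrite ij in AP; rewrite lebesgue_rVS1//; apply: integral0_eq => s _ /=.
apply: (IH j); first exact: measurable_xsection.
move=> v t t0; rewrite /xsection/= !inE/= => Av Avt.
apply: (AP _ t t0 Av); congr A : Avt; apply/rowP => k; rewrite !mxE.
case: unliftP => [k' ->|->] /=; last by rewrite mulr0 addr0.
by rewrite !mxE (inj_eq lift_inj).
Qed.

End lebesgue_null.

(** * Boundary points of a convex set along the coordinate axes *)

Section convex_boundary.
Context {R : realType} {d : nat}.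
Local Notation E := 'rV[R]_d.
Variable Omega : set E.
Hypothesis clO : closed Omega.
Hypothesis cvxO : convex_set (Omega : set (convex_lmodType E)).

(** The steps [k.+1%:R^-1] stand for all positive ones: by convexity, if one step stays in [Omega],
    so do the shorter ones. A countable family keeps the set measurable. *)
Let exit_set (i : 'I_d) (s : bool) : set E := Omega `&`
  \bigcap_k [set x | ~ Omega (x + ((-1) ^+ s * k.+1%:R^-1) *: delta_mx 0 i)].

Let measurable_exit_set i s : measurable (exit_set i s).
Proof.
apply: measurableI; first exact: measurable_closed_rV.
apply: bigcapT_measurable => k; apply: measurable_open_rV.
rewrite (_ : [set _ | _] = (fun x => x + ((-1) ^+ s * k.+1%:R^-1) *: delta_mx 0 i) @^-1` (~` Omega)) //.
apply: open_comp; last by rewrite openC.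
by move=> x _; exact: (cvgD cvg_id (cvg_cst _)).
Qed.

Let shrink x i (s : bool) (t : R) (r : R) : Omega x ->
  Omega (x + ((-1) ^+ s * t) *: delta_mx 0 i) -> 0 < r <= t ->
  Omega (x + ((-1) ^+ s * r) *: delta_mx 0 i).
Proof.
move=> Ox Oxt /andP[r0 rt].
have t0 : 0 < t by apply: lt_le_trans rt.
have -> : ((-1) ^+ s * r) *: delta_mx 0 i =
    (r / t) *: (x + ((-1) ^+ s * t) *: delta_mx 0 i - x) :> E.
  rewrite (addrC x) addrK scalerA; congr (_ *: _).
  by rewrite mulrCA divfK// gt_eqF.
apply: convex_segment => //.
by rewrite divr_ge0 ?(ltW r0) ?(ltW t0)//= ler_pdivrMr// mul1r.
Qed.

Let small (t : R) : 0 < t -> exists k : nat, k.+1%:R^-1 <= t.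
Proof.
move=> t0; exists (Num.truncn t^-1); rewrite invf_ple ?posrE//.
by rewrite ltW// truncnS_gt.
Qed.

(** Of two points on a line parallel to axis [i], one lies ahead of the other in direction [s]; the
    rear one reaches it inside [Omega], so it does not exit. *)
Let exit_set_transversal i s x t : t != 0 -> exit_set i s x ->
  ~ exit_set i s (x + t *: delta_mx 0 i).
Proof.
have main (y : E) (r : R) : 0 < r -> exit_set i s y ->
    ~ Omega (y + ((-1) ^+ s * r) *: delta_mx 0 i).
  move=> r0 [Oy yk] Oyr; have [k kr] := small r0.
  by apply: (yk k I); apply: (shrink Oy Oyr); rewrite kr invr_gt0 ltr0n.
move=> t0 xE xtE; have [st|st|/eqP] := ltgtP 0 ((-1) ^+ s * t).
- apply: (main x _ st xE); rewrite mulrA -signr_addb addbb mul1r.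
  by case: xtE.
- rewrite -oppr_gt0 in st; apply: (main _ _ st xtE).
  rewrite mulrN mulrA -signr_addb addbb mul1r scaleNr addrK.
  by case: xE.
- by rewrite eq_sym mulf_eq0 signr_eq0 (negbTE t0).
Qed.

(* A point that leaves [Omega] along some signed coordinate axis is the only
   such point of its axis-parallel line. *)
Lemma axis_interior_ae : exists M : set E, [/\ measurable M,
  lebesgue_rV M = 0%E & forall x, Omega x -> ~ M x -> axis_interior Omega x].
Proof.
exists (\bigcup_(p in [set: 'I_d * bool]) exit_set p.1 p.2); split.
- by apply: fin_bigcup_measurable => // p _; exact: measurable_exit_set.
- apply/eqP; rewrite -measure_le0.
  apply: (@le_trans _ _ (\sum_(p \in [set: 'I_d * bool]) lebesgue_rV (exit_set p.1 p.2))%E).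
    apply: content_sub_fsum => //.
      exact: finite_finset.
    by apply: fin_bigcup_measurable => // p _; exact: measurable_exit_set.
  rewrite fsbig1// => p _.
  apply: (lebesgue_rV_transversal (i := p.1)); first exact: measurable_exit_set.
  exact: exit_set_transversal.
- move=> x Ox xM i.
  have H (s : bool) : exists k : nat, Omega (x + ((-1) ^+ s * k.+1%:R^-1) *: delta_mx 0 i).
    apply: contrapT => nk; apply: xM; exists (i, s) => //; split => // k _ /= Ok.
    by apply: nk; exists k.
  have [[k1 O1] [k2 O2]] := (H false, H true).
  have m0 : 0 < Num.min (k1.+1%:R^-1 : R) k2.+1%:R^-1.
    by rewrite lt_min !invr_gt0 !ltr0n.
  exists (Num.min k1.+1%:R^-1 k2.+1%:R^-1) => //; split.
    rewrite -[X in X *: _]mul1r; apply: (@shrink _ _ false _ _ Ox O1).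
    by rewrite m0 ge_min lexx.
  rewrite -scaleNr -mulN1r; apply: (@shrink _ _ true _ _ Ox O2).
  by rewrite m0 ge_min lexx orbT.
Qed.

End convex_boundary.

(** * Finite measures and measures with a density *)

Lemma fin_num_finite_measure d (T : measurableType d) (R : realType)
    (g : {measure set T -> \bar R}) : fin_num_fun g ->
  exists gF : {finite_measure set T -> \bar R},
    g = gF :> {measure set T -> \bar R}.
Proof.
move=> gfin.
have gsf : sigma_finite setT g.
  by apply: fin_num_fun_sigma_finite => //; rewrite measure0.
pose H1 := isFinite.Build _ _ _ _ gfin.
pose H2 := isSFinite.Build _ _ _ _ (sfinite_measure_sigma_finite gsf).
pose H3 := isSigmaFinite.Build _ _ _ _ gsf.
exists (HB.pack_for (FiniteMeasure.type T R) (Measure.sort g) H1 H2 H3).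
exact: eq_measure.
Qed.

Lemma density_measure d (T : measurableType d) (R : realType)
    (mu : {measure set T -> \bar R}) (f : T -> \bar R) :
  measurable_fun setT f -> (forall x, 0 <= f x)%E ->
  exists m : {measure set T -> \bar R}, forall A, m A = (\int[mu]_(x in A) f x)%E.
Proof.
move=> mf f0; pose m A := (\int[mu]_(x in A) f x)%E.
have m0 : m set0 = 0%E by rewrite /m integral_set0.
have m_ge0 A : (0 <= m A)%E by exact: integral_ge0.
have msa : semi_sigma_additive m by exact: semi_sigma_additive_nng_induced.
pose H := isMeasure.Build _ _ _ m m0 m_ge0 msa.
by exists (HB.pack_for (Measure.type T R) m H).
Qed.

Section density.
Context d (T : measurableType d) (R : realType).
Variables (mu m : {measure set T -> \bar R}) (f : T -> \bar R).
Hypothesis mf : measurable_fun setT f.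
Hypothesis f0 : forall x, (0 <= f x)%E.
Hypothesis ffin : forall x, f x \is a fin_num.
Hypothesis mE : forall A, measurable A -> m A = (\int[mu]_(x in A) f x)%E.
Local Open Scope ereal_scope.

Import HBNNSimple.

Let integral_density_nnsfun (h : {nnsfun T >-> R}) :
  \int[m]_x (h x)%:E = \int[mu]_x ((h x)%:E * f x).
Proof.
have hE x : (h x)%:E = \sum_(r \in range h) (r * \1_(h @^-1` [set r]) x)%:E.
  by rewrite fsumEFin// -fimfunE.
under eq_integral do rewrite hE.
rewrite ge0_integral_fsum//; last 2 first.
- by move=> r; exact/measurable_EFinP/measurable_funM.
- by move=> r x _; rewrite nnfun_muleindic_ge0.
under [RHS]eq_integral => x _.
  rewrite hE ge0_mule_fsuml; last by move=> r; rewrite nnfun_muleindic_ge0.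
  over.
rewrite ge0_integral_fsum//; last 2 first.
- move=> r; apply: emeasurable_funM => //.
  exact/measurable_EFinP/measurable_funM.
- by move=> r x _; rewrite mule_ge0// nnfun_muleindic_ge0.
apply: eq_fsbigr => r /[!inE] -[x _ <-].
have h0 : (0 <= (h x)%:E)%E by rewrite lee_fin.
under [RHS]eq_integral do rewrite EFinM -muleA.
rewrite integralZl_indic_nnsfun// ge0_integralZl//; last 2 first.
- by apply: emeasurable_funM => //; exact/measurable_EFinP.
- by move=> y _; rewrite mule_ge0// lee_fin.
congr (_ * _); rewrite integral_indic// setIT mE// integral_mkcond.
by apply: eq_integral => y _; rewrite epatch_indic muleC.
Qed.

Lemma ge0_integral_density (F : T -> \bar R) :
  measurable_fun setT F -> (forall x, 0 <= F x) ->
  \int[m]_x F x = \int[mu]_x (F x * f x).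
Proof.
move=> mF F0; pose F_ := nnsfun_approx measurableT mF.
have cF x : (F_ n x)%:E @[n --> \oo] --> F x.
  by apply: cvg_nnsfun_approx.
have ndF x : {homo (fun n => (F_ n x)%:E) : n m / (n <= m)%N >-> n <= m}.
  by move=> a b ab; rewrite lee_fin; exact/lefP/nd_nnsfun_approx.
have F_0 n x : 0 <= (F_ n x)%:E by rewrite lee_fin.
have mF_ n : measurable_fun setT (fun x => (F_ n x)%:E) by exact/measurable_EFinP.
transitivity (limn (fun n => \int[m]_x (F_ n x)%:E)).
  rewrite -monotone_convergence//.
  by apply: eq_integral => x _; apply/esym/cvg_lim.
under eq_fun do rewrite integral_density_nnsfun.
rewrite -monotone_convergence//.
- apply: eq_integral => x _; apply/cvg_lim => //.
  by apply: cvgeZr.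
- by move=> n; exact: emeasurable_funM.
- by move=> n x _; rewrite mule_ge0.
- by move=> x _ a b ab; rewrite lee_wpmul2r// ndF.
Qed.

Lemma integral_density (F : T -> \bar R) :
  measurable_fun setT F -> \int[m]_x F x = \int[mu]_x (F x * f x).
Proof.
move=> mF; rewrite integralE [RHS]integralE.
rewrite !ge0_integral_density//; last 2 first.
- exact: measurable_funeneg.
- exact: measurable_funepos.
congr (_ - _); apply: eq_integral => x _.
  by rewrite !funeposE maxe_pMl// mul0e.
by rewrite !funenegE maxe_pMl// mul0e mulNe.
Qed.

End density.

(** * Lipschitz functions determine a finite measure *)

Section lipschitz_uniqueness.
Context {R : realType} {d : nat}.
Local Notation E := 'rV[R]_d.

Lemma within_continuous_measurable (D : set E) (f : E -> R) : closed D ->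
  {within D, continuous f} -> measurable_fun D f.
Proof.
move=> cD cf; apply: (measurability _ (RGenOpens.measurableE R)) => _ [_ [a [b ->]] <-].
have /open_subspaceP[V oV VD] : open (f @^-1` `]a, b[%classic : set (subspace D)).
  by apply: open_comp => // x _; exact: cf.
rewrite setIC -VD; apply: measurableI; first exact: measurable_open_rV.
exact: measurable_closed_rV.
Qed.

Lemma within_continuous_measurable_rV (D : set E) (f : E -> E) : closed D ->
  {within D, continuous f} -> measurable_fun D f.
Proof.
move=> cD cf; apply: (@measurability _ _ _ _ _ _ (@open E)) => // _ [U oU <-].
have /open_subspaceP[V oV VD] : open (f @^-1` U : set (subspace D)).
  by apply: open_comp => // x _; exact: cf.
rewrite setIC -VD; apply: measurableI; first exact: measurable_open_rV.
exact: measurable_closed_rV.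
Qed.

Definition lipschitz_norm2 (V : normedModType R) (D : set E) (L : R) (h : E -> V) :=
  forall x y, D x -> D y -> `|h x - h y| <= L * norm2 (x - y).

Lemma lipschitz_norm2_continuous (V : normedModType R) (D : set E) (L : R)
    (h : E -> V) : lipschitz_norm2 D L h ->
  {within D, continuous h}.
Proof.
move=> hL; apply/subspace_continuousP => x Dx.
apply/cvgrPdist_le => /= e e0.
have L0 : 0 < `|L| * d%:R + 1 by rewrite ltr_wpDl// mulr_ge0.
rewrite near_withinE; near=> y => Dy.
rewrite (le_trans (hL _ _ Dx Dy))//.
have xy : `|x - y| < e / (`|L| * d%:R + 1).
  have : ball x (e / (`|L| * d%:R + 1)) y.
    by near: y; apply: nbhsx_ballx; rewrite divr_gt0.
  by rewrite -ball_normE.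
rewrite ltr_pdivlMr// in xy; rewrite (le_trans _ (ltW xy))//.
rewrite (le_trans (ler_wpM2r (norm2_ge0 _) (ler_norm L)))//.
rewrite (le_trans (ler_wpM2l (normr_ge0 L) (norm2_le_mx_norm _)))//.
by rewrite mulrA mulrC ler_wpM2l// lerDl.
Unshelve. all: by end_near. Qed.

Section distance_functions.
Variables (C : set E) (k : nat).

(** The minimum of 1 and [k] times the Euclidean distance to [C]; the element 1 also keeps the set
    nonempty when [C] is empty. *)
Definition dist_trunc (x : E) : R :=
  inf ([set 1] `|` [set k%:R * norm2 (x - z) | z in C]).

Let has_lb x : has_lbound ([set 1] `|` [set k%:R * norm2 (x - z) | z in C]).
Proof.
by exists 0 => _ [->//|[z Cz <-]]; rewrite mulr_ge0// norm2_ge0.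
Qed.

Lemma dist_trunc_ge0 x : 0 <= dist_trunc x.
Proof.
apply: lb_le_inf; first by exists 1; left.
by move=> _ [->//|[z Cz <-]]; rewrite mulr_ge0// norm2_ge0.
Qed.

Lemma dist_trunc_le1 x : dist_trunc x <= 1.
Proof. by apply: ge_inf => //; left. Qed.

Lemma dist_trunc0 x : C x -> dist_trunc x = 0.
Proof.
move=> Cx; apply/eqP; rewrite eq_le dist_trunc_ge0 andbT.
apply: ge_inf => //; right; exists x => //.
by rewrite subrr /norm2 /dotv big1 ?sqrtr0 ?mulr0// => i _; rewrite mxE mul0r.
Qed.

Lemma dist_trunc_lipschitz : lipschitz_norm2 setT k%:R dist_trunc.
Proof.
suff H x y : dist_trunc x <= dist_trunc y + k%:R * norm2 (x - y).
  move=> x y _ _; rewrite ler_distl; apply/andP; split.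
    by rewrite lerBlDr norm2_distC.
  exact: H.
rewrite -lerBlDr; apply: lb_le_inf; first by exists 1; left.
have n0 := norm2_ge0 (x - y).
move=> _ [->|[z Cz <-]]; rewrite lerBlDr.
  by rewrite (le_trans (dist_trunc_le1 x))// lerDl mulr_ge0.
apply: (@le_trans _ _ (k%:R * norm2 (x - z))).
  by apply: ge_inf => //; right; exists z.
rewrite -mulrDr ler_wpM2l// (le_trans _ (norm2D _ _))//.
by rewrite [X in _ <= norm2 X]addrC subrKA.
Qed.

Lemma measurable_dist_trunc : measurable_fun setT dist_trunc.
Proof.
apply: within_continuous_measurable; first exact: closedT.
exact: (lipschitz_norm2_continuous dist_trunc_lipschitz).
Qed.

End distance_functions.

Lemma dist_trunc_homo C x : {homo (fun k => dist_trunc C k x) : n m / (n <= m)%N >-> n <= m}.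
Proof.
move=> n m nm; apply: lb_le_inf; first by exists 1; left.
move=> _ [->|[z Cz <-]]; first exact: dist_trunc_le1.
apply: (@le_trans _ _ (n%:R * norm2 (x - z))).
  apply: ge_inf; last by right; exists z.
  by exists 0 => _ [->//|[? ? <-]]; rewrite mulr_ge0// norm2_ge0.
by rewrite ler_wpM2r ?norm2_ge0// ler_nat.
Qed.

Lemma dist_trunc_cvg C x : closed C ->
  dist_trunc C k x @[k --> \oo] --> (\1_(~` C) x : R).
Proof.
move=> cC; rewrite indicE; have [xC|xC] := pselect (C x).
  rewrite (_ : x \in ~` C = false); last by apply/negP; rewrite inE => /(_ xC).
  by under eq_fun do rewrite dist_trunc0//; exact: cvg_cst.
rewrite mem_set//.
have [e /= e0 eC] : exists2 e : R, 0 < e & ball x e `<=` ~` C.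
  by apply/nbhs_ballP; apply: open_nbhs_nbhs; split => //; rewrite openC.
apply: cvg_near_cst; near=> k.
apply/eqP; rewrite eq_le dist_trunc_le1/=.
apply: lb_le_inf; first by exists 1; left.
move=> _ [->//|[z Cz <-]].
have ez : e <= norm2 (x - z).
  rewrite (le_trans _ (mx_norm_le_norm2 _))// leNgt; apply/negP => ze.
  by apply: (eC z) => //; rewrite -ball_normE.
have ke : e^-1 <= k%:R by near: k; exact: nbhs_infty_ger.
by rewrite (le_trans _ (ler_wpM2l _ ez))// -ler_pdivrMr// div1r.
Unshelve. all: by end_near. Qed.

(* The functions [dist_trunc (~` U) k] increase to the indicator of an open [U]. *)
Lemma finite_measure_lipschitz_eq (m1 m2 : {finite_measure set E -> \bar R}) :
  (forall (h : E -> R) (L : R), (forall x, 0 <= h x <= 1) ->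
    lipschitz_norm2 setT L h -> (\int[m1]_x (h x)%:E = \int[m2]_x (h x)%:E)%E) ->
  forall A, measurable A -> m1 A = m2 A.
Proof.
move=> H; apply: (@measure_unique _ _ _ (@open E) (fun=> setT)) => //.
- exact: openI.
- by move=> _; exact: openT.
- by apply/seteqP; split => // x _; exists 0%N.
- move=> U oU.
  have lim (m : {finite_measure set E -> \bar R}) :
      (m U = limn (fun k => \int[m]_x (dist_trunc (~` U) k x)%:E))%E.
    rewrite -monotone_convergence//.
    - rewrite -[in LHS](setIT U) -integral_indic//; last exact: measurable_open_rV.
      apply: eq_integral => x _; apply/esym/cvg_lim => //.
      apply: cvg_EFin; first by near=> k.
      by rewrite -[in X in _ --> X](setCK U); apply: dist_trunc_cvg; rewrite closedC.
    - by move=> k; apply/measurable_EFinP; exact: measurable_dist_trunc.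
    - by move=> k x _; rewrite lee_fin dist_trunc_ge0.
    - by move=> x _ a b ab; rewrite lee_fin dist_trunc_homo.
  apply: (etrans (lim m1)); apply: (etrans _ (esym (lim m2))).
  congr (limn _); apply/funext => k.
  apply: (H _ k%:R) => //; last exact: dist_trunc_lipschitz.
  by move=> x; rewrite dist_trunc_ge0 dist_trunc_le1.
- by move=> _; rewrite ltey_eq fin_num_measure.
Unshelve. all: by end_near. Qed.

End lipschitz_uniqueness.

Section discrete_measures.
Context d (T : measurableType d) (R : realType).
Local Open Scope ereal_scope.

(** Dirac masses are added one index at a time, which gives the integrals of nonnegative functions.
    As the weights are real the total is finite, and a signed [F] is then split into its two
    parts. *)
Lemma discrete_measure (I : finType) (a : I -> R) (x : I -> T) :
  (forall i, 0 <= a i)%R ->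
  exists2 g : {finite_measure set T -> \bar R},
    forall A, measurable A -> g A = \sum_i (a i)%:E * \d_(x i) A &
    forall F : T -> R, measurable_fun setT F ->
      \int[g]_z (F z)%:E = (\sum_i a i * F (x i))%:E.
Proof.
move=> a0.
suff [g gE gI] : exists2 g : {measure set T -> \bar R},
    forall A, measurable A -> g A = \sum_i (a i)%:E * \d_(x i) A &
    forall F : T -> R, measurable_fun setT F -> (forall z, 0 <= F z)%R ->
      \int[g]_z (F z)%:E = (\sum_i a i * F (x i))%:E.
  have gfin : fin_num_fun g.
    move=> A mA; rewrite gE//; under eq_bigr do rewrite diracE -EFinM.
    by rewrite sumEFin.
  have [gF gFE] := fin_num_finite_measure gfin.
  rewrite gFE in gE gI; exists gF => [A mA|F mF]; first exact: gE.
  rewrite integralE.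
  rewrite (_ : (fun z => (F z)%:E)^\+ = EFin \o F^\+%R); last exact: funerpos.
  rewrite (_ : (fun z => (F z)%:E)^\- = EFin \o F^\-%R); last exact: funerneg.
  rewrite !gI; last 4 first.
  - exact: measurable_funrneg.
  - by move=> z; rewrite funrneg_ge0.
  - exact: measurable_funrpos.
  - by move=> z; rewrite funrpos_ge0.
  rewrite -EFinB -sumrB; congr (_%:E); apply: eq_bigr => i _.
  by rewrite -mulrBr; congr (_ * _)%R; rewrite -[in RHS](funrposBneg F).
elim: (index_enum I) => [|i s [g gE gI]].
  exists mzero => [A mA|F mF F0]; first by rewrite big_nil.
  by rewrite integral_measure_zero big_nil.
pose ai := NngNum (a0 i).
exists (measure_add (mscale ai \d_(x i)) g) => [A mA|F mF F0].
  by rewrite big_cons -gE//; exact: measure_addE.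
have F0' z : setT z -> 0 <= (F z)%:E by rewrite lee_fin.
have mF' : measurable_fun setT (EFin \o F) by exact/measurable_EFinP.
rewrite ge0_integral_measure_add// ge0_integral_mscale//.
rewrite integral_dirac//.
by rewrite diracT mul1e gI// big_cons EFinD EFinM.
Qed.

End discrete_measures.

Section bounded_measurable.
Context d (T : measurableType d) (R : realType).
Implicit Types (D : set T) (f g : T -> R).

(** A class closed under the operations used below and integrable for every finite measure, so that
    integrability needs no separate bookkeeping. *)
Definition bounded_measurable D f :=
  measurable_fun D f /\ exists M : R, forall x, D x -> `|f x| <= M.

Lemma bounded_measurable_cst D (c : R) : bounded_measurable D (fun=> c).
Proof. by split; [exact: measurable_cst|exists `|c|]. Qed.

Lemma bounded_measurableD D f g : bounded_measurable D f -> bounded_measurable D g ->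
  bounded_measurable D (fun x => f x + g x).
Proof.
move=> [mf [M fM]] [mg [N gN]]; split; first exact: measurable_funD.
exists (M + N) => x Dx; rewrite (le_trans (ler_normD _ _))// lerD//.
  exact: fM.
exact: gN.
Qed.

Lemma bounded_measurableM D f g : bounded_measurable D f -> bounded_measurable D g ->
  bounded_measurable D (fun x => f x * g x).
Proof.
move=> [mf [M fM]] [mg [N gN]]; split; first exact: measurable_funM.
by exists (M * N) => x Dx; rewrite normrM ler_pM// ?fM// gN.
Qed.

Lemma bounded_measurableZ D (c : R) f : bounded_measurable D f ->
  bounded_measurable D (fun x => c * f x).
Proof. exact: bounded_measurableM (bounded_measurable_cst D c). Qed.

Lemma bounded_measurableN D f : bounded_measurable D f ->
  bounded_measurable D (fun x => - f x).
Proof.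
by move=> bf; under eq_fun do rewrite -mulN1r; exact: bounded_measurableZ.
Qed.

Lemma bounded_measurableB D f g : bounded_measurable D f -> bounded_measurable D g ->
  bounded_measurable D (fun x => f x - g x).
Proof. by move=> bf bg; exact: bounded_measurableD bf (bounded_measurableN bg). Qed.

Lemma bounded_measurable_expR D f : bounded_measurable D f ->
  bounded_measurable D (fun x => expR (f x)).
Proof.
move=> [mf [M fM]]; split; first exact: measurableT_comp.
exists (expR M) => x Dx; rewrite ger0_norm ?expR_ge0// ler_expR.
by rewrite (le_trans (ler_norm _))// fM.
Qed.

Lemma bounded_measurable_integrable (mu : {finite_measure set T -> \bar R}) D f :
  measurable D -> bounded_measurable D f -> mu.-integrable D (EFin \o f).
Proof.
move=> mD [mf [M fM]]; apply: measurable_bounded_integrable => //.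
  by rewrite ltey_eq fin_num_measure.
by exists M; split; [exact: num_real|move=> N MN x /= Dx; exact: le_trans (fM _ Dx) (ltW MN)].
Qed.

Lemma integral_bounded_measurable (mu : {finite_measure set T -> \bar R}) D f :
  measurable D -> bounded_measurable D f ->
  (\int[mu]_(x in D) (f x)%:E = (Rintegral mu D f)%:E)%E.
Proof.
move=> mD bf; rewrite fineK//; apply: integrable_fin_num => //.
exact: bounded_measurable_integrable.
Qed.

End bounded_measurable.

(** * First variation of the dual objective *)

Section optimality.
Context {R : realType} {d : nat}.
Local Notation E := 'rV[R]_d.
Variables (Omega : set E) (mu nu : {finite_measure set E -> \bar R}).
Variables (phi psi : E -> R) (S : E -> E) (k : R).
Hypothesis clO : closed Omega.
Hypothesis k0 : 0 < k.
Hypothesis cS : {within Omega, continuous S}.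
Hypothesis gap : forall x y, Omega x -> Omega y ->
  phi x + psi y + k / 2 * norm2 (x - S y) ^+ 2 <= cost x y.
Hypotheses (bphi : Cb Omega phi) (bpsi : Cb Omega psi).
Hypothesis opt : forall p, dual_admissible Omega p ->
  (dual_objective Omega mu nu p <= dual_objective Omega mu nu (phi, psi))%E.

Let mO : measurable Omega.
Proof. exact: measurable_closed_rV. Qed.

Lemma Cb_bounded_measurable f : Cb Omega f -> bounded_measurable Omega f.
Proof.
by move=> [cf [M fM]]; split; [exact: within_continuous_measurable|exists M].
Qed.

(** First [expR s <= (1 - s)^-1]; then [(1 + s + 2 * s ^+ 2) * (1 - s) = 1 + s ^+ 2 * (1 - 2 * s)],
    which is at least 1 in this range. *)
Lemma expR_le_quadratic (s : R) : s <= 2^-1 -> expR s <= 1 + s + 2 * s ^+ 2.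
Proof.
move=> s12; have s1 : 0 < 1 - s by lra.
have h : expR s <= (1 - s)^-1.
  rewrite -[expR s]invrK -expRN lef_pV2 ?posrE ?expR_gt0//.
  exact: expR_ge1Dx.
rewrite (le_trans h)// -[leLHS]mul1r ler_pdivrMr//.
have := sqr_ge0 s; nra.
Qed.

Section perturbation.
Variables (h : E -> R) (L : R).
Hypothesis h01 : forall x, 0 <= h x <= 1.
Hypothesis hL : lipschitz_norm2 setT L h.

Let hS_continuous : {within Omega, continuous (fun y => h (S y))}.
Proof.
have ch : {within setT, continuous h} := lipschitz_norm2_continuous hL.
have {}ch : continuous h by apply/continuous_subspace_setT.
by move=> y; apply: continuous_comp; [exact: cS|exact: ch].
Qed.

(** [t ^+ 2 * K] is the maximum over [r] of [t * L * r - k / 2 * r ^+ 2]: the excess of the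
    Lipschitz error of [t * h] over the slack left by [gap]. *)
Let K := L ^+ 2 / (2 * k).

Let K0 : 0 <= K.
Proof. by rewrite /K divr_ge0// ?sqr_ge0// mulr_ge0// ltW. Qed.

Let perturbed (t : R) : (E -> R) * (E -> R) :=
  (fun x => phi x + t * h x, fun y => psi y - (t * h (S y) + t ^+ 2 * K)).

Let perturbed_admissible t : dual_admissible Omega (perturbed t).
Proof.
have ch : {within Omega, continuous h}.
  by apply: (lipschitz_norm2_continuous (L := L)) => x y _ _; exact: hL.
split=> /=.
- case: bphi => cf [M fM]; split.
    move=> x; apply: cvgD; first exact: cf.
    by apply: cvgM; [exact: cvg_cst|exact: ch].
  exists (M + `|t|) => x Ox; rewrite (le_trans (ler_normD _ _))// lerD ?fM//.
  rewrite normrM ler_piMr//; have /andP[h0 h1] := h01 x.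
  by rewrite ger0_norm.
- case: bpsi => cf [M fM]; split.
    move=> x; apply: cvgB; first exact: cf.
    apply: cvgD; last exact: cvg_cst.
    by apply: cvgM; [exact: cvg_cst|exact: hS_continuous].
  exists (M + (`|t| + t ^+ 2 * K)) => x Ox.
  rewrite (le_trans (ler_normB _ _))// lerD ?fM//.
  rewrite (le_trans (ler_normD _ _))// lerD//.
    rewrite normrM ler_piMr//; have /andP[h0 h1] := h01 (S x).
    by rewrite ger0_norm.
  by rewrite ger0_norm// mulr_ge0// sqr_ge0.
- move=> x y Ox Oy; rewrite -/(cost x y); have := gap Ox Oy.
  have : t * h x <= t * h (S y) + `|t| * (L * norm2 (x - S y)).
    rewrite -lerBlDl -mulrBr (le_trans (ler_norm _))// normrM ler_wpM2l//.
    exact: hL.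
  have : `|t| * (L * norm2 (x - S y)) <= k / 2 * norm2 (x - S y) ^+ 2 + t ^+ 2 * K.
    rewrite -subr_ge0 /K -(real_normK (num_real t)).
    rewrite (_ : _ - _ = (2 * k)^-1 * (k * norm2 (x - S y) - `|t| * L) ^+ 2).
      by rewrite mulr_ge0 ?sqr_ge0// invr_ge0 mulr_ge0// ltW.
    by field; rewrite gt_eqF.
  lra.
Qed.

Let a x := expR (- phi x).
Let b y := expR (- psi y).

Let bmphi := Cb_bounded_measurable bphi.
Let bmpsi := Cb_bounded_measurable bpsi.

Let bma : bounded_measurable Omega a.
Proof. exact/bounded_measurable_expR/bounded_measurableN. Qed.

Let bmb : bounded_measurable Omega b.
Proof. exact/bounded_measurable_expR/bounded_measurableN. Qed.

Let bmh : bounded_measurable Omega h.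
Proof.
split; last by exists 1 => x _; have /andP[h0 h1] := h01 x; rewrite ger0_norm.
apply: within_continuous_measurable => //.
by apply: (lipschitz_norm2_continuous (L := L)) => x y _ _; exact: hL.
Qed.

Let bmhS : bounded_measurable Omega (fun y => h (S y)).
Proof.
split; last by exists 1 => x _; have /andP[h0 h1] := h01 (S x); rewrite ger0_norm.
exact: within_continuous_measurable.
Qed.

Let A := Rintegral mu Omega (fun x => h x * a x).
Let B := Rintegral nu Omega (fun y => h (S y) * b y).
(** Collects the second-order terms. The factor 2 is that of [expR_le_quadratic]; on the side of
    [nu] the correction [t ^+ 2 * K] contributes [K], and the whole perturbation is at most [1 + K]
    times the absolute value of [t]. *)
Let C := 2 * Rintegral mu Omega a + (K + 2 * (1 + K) ^+ 2) * Rintegral nu Omega b.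

Let dual_real p : Cb Omega p.1 -> Cb Omega p.2 ->
  dual_objective Omega mu nu p =
  (Rintegral mu Omega (fun x => 1 - expR (- p.1 x)) +
   Rintegral nu Omega (fun y => 1 - expR (- p.2 y)))%:E.
Proof.
move=> /Cb_bounded_measurable b1 /Cb_bounded_measurable b2.
rewrite /dual_objective EFinD; congr (_ + _)%E.
  apply: integral_bounded_measurable => //.
  apply: bounded_measurableB; first exact: bounded_measurable_cst.
  exact/bounded_measurable_expR/bounded_measurableN.
apply: integral_bounded_measurable => //.
apply: bounded_measurableB; first exact: bounded_measurable_cst.
exact/bounded_measurable_expR/bounded_measurableN.
Qed.

(** The bound on [t] keeps both exponents in the range of [expR_le_quadratic]. Both signs of [t] are
    covered, which turns the inequality into an equality of first-order terms. *)
Let first_variation t : `|t| <= (2 * (1 + K))^-1 -> t * (A - B) <= C * t ^+ 2.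
Proof.
move=> tK.
have t12 : `|t| * (1 + K) <= 2^-1.
  have K1 : 0 < 1 + K by rewrite ltr_wpDr.
  by rewrite -ler_pdivlMr// -invfM.
have t2 : `|t| <= 2^-1 by apply: le_trans t12; rewrite ler_peMr// lerDl.
have := opt (perturbed_admissible t).
have [adm1 adm2 _] := perturbed_admissible t.
rewrite dual_real// dual_real// lee_fin /=.
have I f : bounded_measurable Omega f -> mu.-integrable Omega (EFin \o f).
  exact: bounded_measurable_integrable.
have I' f : bounded_measurable Omega f -> nu.-integrable Omega (EFin \o f).
  exact: bounded_measurable_integrable.
have bm1 : bounded_measurable Omega (fun x => 1 - a x).
  by apply: bounded_measurableB => //; exact: bounded_measurable_cst.
have bm2 : bounded_measurable Omega (fun x => 1 - b x).
  by apply: bounded_measurableB => //; exact: bounded_measurable_cst.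
have bm3 : bounded_measurable Omega (fun x => h x * a x).
  exact: bounded_measurableM.
have bm4 : bounded_measurable Omega (fun x => h (S x) * b x).
  exact: bounded_measurableM.
have muge : Rintegral mu Omega (fun x => 1 - a x) + t * A - 2 * t ^+ 2 * Rintegral mu Omega a <=
    Rintegral mu Omega (fun x => 1 - expR (- (phi x + t * h x))).
  rewrite /A -RintegralZl//; last exact: I.
  rewrite -[X in _ - X]RintegralZl//; last exact: I.
  rewrite -RintegralD//; [|exact: I|exact/I/bounded_measurableZ].
  rewrite -RintegralB//; last 2 first.
  - exact/I/bounded_measurableD/bounded_measurableZ.
  - exact/I/bounded_measurableZ.
  apply: le_Rintegral => //.
  - apply: I; apply: bounded_measurableB; last exact: bounded_measurableZ.
    exact/bounded_measurableD/bounded_measurableZ.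
  - apply: I; apply: bounded_measurableB; first exact: bounded_measurable_cst.
    exact/bounded_measurable_expR/bounded_measurableN/Cb_bounded_measurable.
  - move=> x Ox; rewrite opprD expRD -/(a x); have /andP[h0 h1] := h01 x.
    have a0 : 0 <= a x := expR_ge0 _.
    have th : `|t * h x| <= `|t| by rewrite normrM ler_piMr// ger0_norm.
    have := @expR_le_quadratic (- (t * h x)).
    have : (t * h x) ^+ 2 <= t ^+ 2.
      by rewrite exprMn ler_piMr ?sqr_ge0// expr_le1.
    rewrite sqrrN; have := le_trans th t2; rewrite ler_norml => /andP[u1 u2].
    have u3 : - (t * h x) <= 2^-1 by lra.
    move=> v /(_ u3) w.
    have : a x * expR (- (t * h x)) <= a x * (1 - t * h x + 2 * t ^+ 2).
      by rewrite ler_wpM2l//; lra.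
    lra.
have nuge : Rintegral nu Omega (fun x => 1 - b x) - t * B
      - (K + 2 * (1 + K) ^+ 2) * t ^+ 2 * Rintegral nu Omega b <=
    Rintegral nu Omega (fun y => 1 - expR (- (psi y - (t * h (S y) + t ^+ 2 * K)))).
  rewrite /B -RintegralZl//; last exact: I'.
  rewrite -[X in _ - X - _]RintegralZl//; last exact: I'.
  rewrite -RintegralB//; [|exact: I'|exact/I'/bounded_measurableZ].
  rewrite -RintegralB//; last 2 first.
  - exact/I'/bounded_measurableB/bounded_measurableZ.
  - exact/I'/bounded_measurableZ.
  apply: le_Rintegral => //.
  - apply: I'; apply: bounded_measurableB; last exact: bounded_measurableZ.
    exact/bounded_measurableB/bounded_measurableZ.
  - apply: I'; apply: bounded_measurableB; first exact: bounded_measurable_cst.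
    exact/bounded_measurable_expR/bounded_measurableN/Cb_bounded_measurable.
  - move=> x Ox; rewrite opprB addrC expRD -/(b x).
    have /andP[h0 h1] := h01 (S x); have b0 : 0 <= b x := expR_ge0 _.
    have th : `|t * h (S x)| <= `|t| by rewrite normrM ler_piMr// ger0_norm.
    have tk : t ^+ 2 * K <= `|t| * K.
      rewrite -(real_normK (num_real t)) ler_wpM2r// expr2 ler_piMr//; lra.
    have tk0 : 0 <= t ^+ 2 * K by rewrite mulr_ge0// sqr_ge0.
    set s := t * h (S x) + t ^+ 2 * K.
    have sle : `|s| <= `|t| * (1 + K).
      rewrite /s mulrDr mulr1 (le_trans (ler_normD _ _))// lerD//.
      by rewrite ger0_norm.
    have s2 : s ^+ 2 <= t ^+ 2 * (1 + K) ^+ 2.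
      rewrite -(real_normK (num_real s)) -(real_normK (num_real t)) -exprMn.
      by rewrite ler_pXn2r// nnegrE// mulr_ge0// addr_ge0.
    have : s <= 2^-1 by rewrite (le_trans (ler_norm _))// (le_trans sle).
    move=> /expR_le_quadratic se.
    have {}se : expR s <= 1 + s + 2 * (t ^+ 2 * (1 + K) ^+ 2) by lra.
    have : b x * expR s <= b x * (1 + s + 2 * (t ^+ 2 * (1 + K) ^+ 2)).
      by rewrite ler_wpM2l.
    rewrite /s; lra.
move=> le0; rewrite /C; move: muge nuge le0; rewrite -/(a _) -/(b _).
move: (Rintegral mu Omega _) (Rintegral nu Omega _) => *; lra.
Qed.

Lemma transport_lipschitz :
  (\int[mu]_(x in Omega) (h x * expR (- phi x))%:E =
   \int[nu]_(y in Omega) (h (S y) * expR (- psi y))%:E)%E.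
Proof.
rewrite !integral_bounded_measurable//; last 2 first.
- exact: bounded_measurableM.
- exact: bounded_measurableM.
congr (_%:E); rewrite -/A -/B; apply/eqP; rewrite -subr_eq0; apply/eqP.
have K1 : 0 < 1 + K by rewrite ltr_wpDr.
apply: contrapT => /eqP AB.
have C0 : 0 < `|C| + 1 by rewrite ltr_wpDl.
(* The second bound makes [C * r ^+ 2] smaller than [r] times the absolute value of [A - B], which
   is the left side of [first_variation] at [Num.sg (A - B) * r]. *)
pose r := Num.min (2 * (1 + K))^-1 (`|A - B| / (2 * (`|C| + 1))).
have AB0 : 0 < `|A - B| by rewrite normr_gt0.
have r0 : 0 < r.
  by rewrite lt_min invr_gt0 mulr_gt0//= divr_gt0// mulr_gt0.
have rK : r <= (2 * (1 + K))^-1 by rewrite /r ge_min lexx.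
have rAB : r * (`|C| + 1) <= `|A - B| / 2.
  apply: (@le_trans _ _ (`|A - B| / (2 * (`|C| + 1)) * (`|C| + 1))).
    by rewrite ler_wpM2r ?(ltW C0)// /r ge_min lexx orbT.
  by rewrite le_eqVlt; apply/orP; left; apply/eqP; field; rewrite gt_eqF.
have := @first_variation (Num.sg (A - B) * r).
rewrite normrM normr_sg AB mul1r gtr0_norm// => /(_ rK).
rewrite mulrAC mulrC -normrEsg exprMn sqr_sg AB mul1r.
have := ler_norm C; nra.
Qed.

End perturbation.

Local Notation aE := ((fun x => expR (- phi x)) \_ Omega).
Local Notation bE := ((fun y => expR (- psi y)) \_ Omega).

(* Optimality in the direction of all Lipschitz perturbations: [S] pushes
   [exp (- psi) nu] forward to [exp (- phi) mu]. *)
Lemma transport (F : E -> \bar R) : measurable_fun setT F ->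
  (forall x, 0 <= F x)%E -> measurable_fun setT S ->
  (\int[mu]_x (F x * (aE x)%:E) = \int[nu]_y (F (S y) * (bE y)%:E))%E.
Proof.
move=> mF F0 mS.
have ext0 f x : 0 <= ((fun x => expR (- f x)) \_ Omega) x :> R.
  by rewrite patchE; case: ifP => // _; exact: expR_ge0.
have mext f : Cb Omega f -> measurable_fun setT ((fun x => expR (- f x)) \_ Omega : E -> R).
  move=> /Cb_bounded_measurable bf.
  apply/(measurable_restrict _ mO measurableT); rewrite setTI.
  by case: (bounded_measurable_expR (bounded_measurableN bf)).
have bext f : Cb Omega f -> bounded_measurable setT ((fun x => expR (- f x)) \_ Omega : E -> R).
  move=> bf; split; first exact: mext.
  have [_ [M fM]] := Cb_bounded_measurable bf; exists (expR M) => x _.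
  rewrite patchE; case: ifPn => [/[!inE] Ox|_]; last by rewrite normr0 expR_ge0.
  rewrite ger0_norm ?expR_ge0// ler_expR (le_trans (ler_norm _))// normrN.
  exact: fM.
have fin (m : {finite_measure set E -> \bar R}) f A : Cb Omega f -> measurable A ->
    (\int[m]_(x in A) (((fun x => expR (- f x)) \_ Omega) x)%:E)%E \is a fin_num.
  move=> /bext[mf [M fM]] mA; apply: integrable_fin_num => //.
  apply: bounded_measurable_integrable => //; split; first exact: measurable_funTS.
  by exists M => x _; exact: fM.
have mE f : Cb Omega f ->
    measurable_fun setT (fun x => (((fun x => expR (- f x)) \_ Omega) x)%:E).
  by move=> bf; apply/measurable_EFinP; exact: mext.
have E0 (f : E -> R) x : (0 <= (((fun x => expR (- f x)) \_ Omega) x)%:E)%E.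
  by rewrite lee_fin; exact: ext0.
(* The two sides integrate [F] against the measure [m1] of density [aE] and against the image [m2S]
   of the weighted [nu]. These are finite and agree on Lipschitz functions with values between 0 and
   1, hence on Borel sets. *)
have [m1 m1E] := density_measure mu (mE _ bphi) (E0 phi).
have [m2 m2E] := density_measure nu (mE _ bpsi) (E0 psi).
pose m2S : {measure set E -> \bar R} :=
  measure_function_pushforward__canonical__measure_function_Measure m2 mS.
have m1I (G : E -> \bar R) : measurable_fun setT G -> (forall x, 0 <= G x)%E ->
    (\int[m1]_x G x = \int[mu]_x (G x * (aE x)%:E))%E.
  by move=> mG G0; apply: (ge0_integral_density (mE _ bphi) (E0 phi)) => // A _; exact: m1E.
have m2I (G : E -> \bar R) : measurable_fun setT G -> (forall x, 0 <= G x)%E ->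
    (\int[m2S]_x G x = \int[nu]_y (G (S y) * (bE y)%:E))%E.
  move=> mG G0; rewrite ge0_integral_pushforward// preimage_setT.
  have mGS : measurable_fun setT (G \o S) by exact: measurableT_comp.
  by rewrite (ge0_integral_density (mE _ bpsi) (E0 psi) _ (fun A _ => m2E A) mGS)// => x /=.
have [m1F m1FE] : exists m : {finite_measure set E -> \bar R}, m1 = m.
  by apply: fin_num_finite_measure => A mA; rewrite m1E fin.
have [m2F m2FE] : exists m : {finite_measure set E -> \bar R}, m2S = m.
  apply: fin_num_finite_measure => A mA; rewrite /m2S /= /pushforward m2E fin//.
  by rewrite -[X in measurable X]setTI; exact: (mS measurableT _ mA).
have m12 A : measurable A -> m1 A = m2S A.
  rewrite m1FE m2FE; apply: finite_measure_lipschitz_eq => h L h01 hL.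
  have mh : measurable_fun setT (fun x => (h x)%:E).
    apply/measurable_EFinP; apply: within_continuous_measurable; first exact: closedT.
    exact: lipschitz_norm2_continuous hL.
  have h0 x : (0 <= (h x)%:E)%E by rewrite lee_fin; have /andP[] := h01 x.
  transitivity (\int[m1]_x (h x)%:E)%E; first by rewrite m1FE.
  transitivity (\int[m2S]_x (h x)%:E)%E; last by rewrite m2FE.
  rewrite m1I// m2I//.
  have := transport_lipschitz h01 hL; rewrite integral_mkcond [in RHS]integral_mkcond.
  congr (_ = _); apply: eq_integral => x _; rewrite !patchE; case: ifP => _.
  - by rewrite EFinM.
  - by rewrite mule0.
  - by rewrite EFinM.
  - by rewrite mule0.
by rewrite -m1I// -m2I//; apply: eq_measure_integral => A mA _; exact: m12.
Qed.

End optimality.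

Section integral_bounds.
Context d (T : measurableType d) (R : realType).
Local Open Scope ereal_scope.

(** No integrability of [h] is assumed: dropping its negative part can only increase the
    integral. *)
Lemma ae_integral_le_ge0 (mu : {measure set T -> \bar R}) (h F : T -> \bar R) :
  measurable_fun setT h -> measurable_fun setT F -> (forall x, 0 <= F x) ->
  {ae mu, forall x, h x <= F x} -> \int[mu]_x h x <= \int[mu]_x F x.
Proof.
move=> mh mF F0 hF; rewrite integralE.
apply: (@le_trans _ _ (\int[mu]_x h^\+ x)).
  by rewrite geeDl// oppe_le0 integral_ge0.
apply: ae_ge0_le_integral => //; first exact: measurable_funepos.
by apply: filterS hF => x hx _; rewrite funeposE ge_max hx F0.
Qed.

End integral_bounds.

(** * Weak duality *)

Section weak_duality.
Context {R : realType} {d : nat}.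
Local Notation E := 'rV[R]_d.

Definition entropy (s : R) : R := s * ln s - s + 1.

(** Fenchel-Young for [entropy], whose conjugate at [- p] is [expR (- p) - 1]. For positive [s] it
    is [1 + u <= expR u] at [u = - p - ln s], multiplied by [s]; the value at 0 is treated apart,
    [ln 0] being a default. *)
Lemma entropy_duality (s p : R) : 0 <= s -> 1 - expR (- p) - p * s <= entropy s.
Proof.
rewrite /entropy le_eqVlt => /predU1P[<-|s0].
  by rewrite mulr0 mul0r; have := expR_gt0 (- p); lra.
have := expR_ge1Dx (- p - ln s).
rewrite expRD (expRN (ln s)) lnK// => h.
have : s * (1 + (- p - ln s)) <= expR (- p).
  by rewrite mulrC -ler_pdivlMr.
lra.
Qed.

Lemma entropy_ge0 (s : R) : 0 <= s -> 0 <= entropy s.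
Proof. by move=> /(entropy_duality 0); rewrite oppr0 expR0; lra. Qed.

Lemma measurable_entropy : measurable_fun setT entropy.
Proof.
apply: measurable_funD => //; apply: measurable_funB => //.
by apply: measurable_funM => //; exact: measurable_ln.
Qed.

Lemma measurable_cost : measurable_fun setT (fun z : E * E => cost z.1 z.2).
Proof.
rewrite (_ : (fun _ => _) = fun z : E * E =>
    2^-1 * \sum_(i < d) (z.1 0 i - z.2 0 i) * (z.1 0 i - z.2 0 i)); last first.
  by apply/funext => z; rewrite costE /dotv; under eq_bigr do rewrite !mxE.
apply: measurable_funM => //; apply: measurable_sum => i.
have m : measurable_fun setT (fun z : E * E => z.1 0 i - z.2 0 i).
  apply: measurable_funB.
    by apply: (measurableT_comp (measurable_coord_rV i)); exact: measurable_fst.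
  by apply: (measurableT_comp (measurable_coord_rV i)); exact: measurable_snd.
exact: measurable_funM.
Qed.

Local Open Scope ereal_scope.

Lemma supported_ae (D : set E) (mu : {measure set E -> \bar R}) : measurable D ->
  supported_on D mu -> {ae mu, forall x, D x}.
Proof.
move=> mD mu0; exists (~` D); split => //; exact: measurableC.
Qed.

(** [entropy_duality] is integrated against [mu] at a density [r] of the image of [gamma]. Without a
    density the infimum defining [KL] is over the empty set and there is nothing to prove. *)
Lemma pushforward_KL_ge (gamma : {finite_measure set (E * E)%type -> \bar R})
    (p : E * E -> E) (mu : {finite_measure set E -> \bar R}) (f : E -> R) :
  measurable_fun setT p -> bounded_measurable setT f ->
  (Rintegral mu setT (fun x => 1 - expR (- f x)) -
   Rintegral gamma setT (fun z => f (p z)))%:E <= KL (pushforward gamma p) mu.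
Proof.
move=> mp bf; apply: le_ereal_inf_tmp => _ [r [mr r0 rE] <-].
have mrE : measurable_fun setT (EFin \o r) by exact/measurable_EFinP.
pose m : {measure set E -> \bar R} :=
  measure_function_pushforward__canonical__measure_function_Measure gamma mp.
have ri : mu.-integrable setT (EFin \o r).
  apply/integrableP; split => //.
  under eq_integral do rewrite /= ger0_norm//.
  by rewrite -rE// /pushforward preimage_setT ltey_eq fin_num_measure.
have bfp : bounded_measurable setT (fun z => f (p z)).
  case: bf => mf [M fM]; split; first exact: measurableT_comp.
  by exists M => z _; exact: fM.
have bone : bounded_measurable setT (fun x => (1 - expR (- f x))%R).
  apply: bounded_measurableB; first exact: bounded_measurable_cst.
  exact/bounded_measurable_expR/bounded_measurableN.
have fri : mu.-integrable setT (EFin \o (fun x => f x * r x)%R).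
  case: bf => mf [M fM]; apply: (@integrableMr _ _ _ mu setT measurableT f (EFin \o r)) => //.
  by exists M; split; [exact: num_real|move=> N MN x /= _; exact: le_trans (fM x I) (ltW MN)].
have frE : (Rintegral gamma setT (fun z => f (p z)))%:E = \int[mu]_x (f x * r x)%:E.
  rewrite -integral_bounded_measurable//.
  have -> : \int[gamma]_z (f (p z))%:E = \int[m]_x (f x)%:E.
    rewrite integral_pushforward//.
      by apply/measurable_EFinP; case: bf.
    by rewrite preimage_setT; exact: bounded_measurable_integrable.
  have r0E x : 0 <= (EFin \o r) x by rewrite lee_fin.
  have mfE : measurable_fun setT (EFin \o f) by apply/measurable_EFinP; case: bf.
  by rewrite (integral_density (mu := mu) (m := m) mrE r0E _ rE mfE).
rewrite EFinB frE -integral_bounded_measurable// -integralB//; last first.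
  exact: bounded_measurable_integrable.
apply: ae_integral_le_ge0.
- apply: emeasurable_funB; apply/measurable_EFinP; first by case: bone.
  by apply: measurable_funM => //; case: bf.
- apply/measurable_EFinP; exact: (measurableT_comp measurable_entropy).
- by move=> x; rewrite lee_fin; exact: entropy_ge0.
- by apply: nearW => x /=; rewrite lee_fin; exact: entropy_duality.
Qed.

Variables (Omega : set E) (mu nu : {finite_measure set E -> \bar R}).
Variables (phi psi : E -> R).
Hypothesis clO : closed Omega.
Hypothesis adm : dual_admissible Omega (phi, psi).

Lemma restrict_bounded_measurable (f : E -> R) : bounded_measurable Omega f ->
  bounded_measurable setT (f \_ Omega).
Proof.
move=> [mf [M fM]]; split.
  apply/(measurable_restrict _ _ measurableT); first exact: measurable_closed_rV.
  by rewrite setTI.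
exists `|M|%R => x _; rewrite patchE; case: ifPn => [/[!inE] Ox|_].
  by rewrite (le_trans (fM _ Ox))// ler_norm.
by rewrite normr0.
Qed.

(** Extension by 0 is harmless because [1 - expR 0] vanishes. *)
Lemma integral_dual_restrict (m : {finite_measure set E -> \bar R}) (f : E -> R) :
  bounded_measurable Omega f ->
  \int[m]_(x in Omega) (1 - expR (- f x))%:E =
  (Rintegral m setT (fun x => 1 - expR (- (f \_ Omega) x)))%:E.
Proof.
move=> /restrict_bounded_measurable bf.
have be : bounded_measurable setT (fun x => (1 - expR (- (f \_ Omega) x))%R).
  apply: bounded_measurableB; first exact: bounded_measurable_cst.
  exact/bounded_measurable_expR/bounded_measurableN.
rewrite -(integral_bounded_measurable m measurableT be) integral_mkcond.
apply: eq_integral => x _; rewrite !patchE.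
by case: ifP => //; rewrite oppr0 expR0 subrr.
Qed.

Lemma weak_duality : dual_objective Omega mu nu (phi, psi) <= UOT Omega mu nu.
Proof.
have [/= bphi bpsi ad] := adm.
have bm1 := Cb_bounded_measurable clO bphi.
have bm2 := Cb_bounded_measurable clO bpsi.
have r1 := restrict_bounded_measurable bm1.
have r2 := restrict_bounded_measurable bm2.
rewrite /dual_objective /= !integral_dual_restrict//.
apply: le_ereal_inf_tmp => _ [gamma gO <-].
have k1 := @pushforward_KL_ge gamma fst mu _ measurable_fst r1.
have k2 := @pushforward_KL_ge gamma snd nu _ measurable_snd r2.
have b1 : bounded_measurable setT (fun z : E * E => (phi \_ Omega) z.1).
  case: r1 => mf [M fM]; split; last by exists M => z _; exact: fM.
  by apply: (measurableT_comp mf); exact: measurable_fst.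
have b2 : bounded_measurable setT (fun z : E * E => (psi \_ Omega) z.2).
  case: r2 => mf [M fM]; split; last by exists M => z _; exact: fM.
  by apply: (measurableT_comp mf); exact: measurable_snd.
have b12 := bounded_measurableD b1 b2.
(* The constraint is available on the square of [Omega], which carries [gamma]. The integrals of the
   potentials here cancel those in [k1] and [k2]. *)
have kc : (Rintegral gamma setT (fun z => (phi \_ Omega) z.1) +
    Rintegral gamma setT (fun z => (psi \_ Omega) z.2))%:E <=
    \int[gamma]_z (2^-1 * norm2 (z.1 - z.2) ^+ 2)%:E.
  rewrite -RintegralD//; [|exact: bounded_measurable_integrable..].
  rewrite -integral_bounded_measurable//.
  apply: ae_integral_le_ge0.
  - by apply/measurable_EFinP; case: b12.
  - by apply/measurable_EFinP; exact: measurable_cost.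
  - by move=> z; rewrite lee_fin; exact: cost_ge0.
  - exists (~` (Omega `*` Omega)); split => //.
      by apply: measurableC; apply: measurableX; exact: measurable_closed_rV.
    move=> z /= zP [z1 z2]; apply: zP; rewrite lee_fin !patchE !mem_set//.
    exact: ad.
apply: le_trans (leeD (leeD kc k1) k2).
by rewrite -!EFinD lee_fin le_eqVlt; apply/orP; left; apply/eqP; ring.
Qed.

End weak_duality.

(** * Disintegration of a coupling with an empirical measure *)

Section semidiscrete_coupling.
Context {R : realType} {d : nat}.
Local Notation E := 'rV[R]_d.
Local Open Scope ereal_scope.
Variables (n : nat) (X : 'I_n -> E) (beta : {finite_measure set E -> \bar R}).
Variable pi : probability (E * E)%type R.
Hypothesis n0 : (0 < n)%N.
Hypothesis cpl : coupling (empirical X) beta pi.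

Let cylinder (a : E) : set (E * E) := [set a] `*` setT.

Let measurable_cylinder a : measurable (cylinder a).
Proof. by apply: measurableX => //; exact: measurable_set1_rV. Qed.

(** The mass that [pi] sends from the point [a] into [A] is at most [beta A], so it has a
    Radon-Nikodym derivative. As the first marginal has finitely many atoms, these derivatives
    amount to a disintegration of [pi] over its second marginal. *)
Let conditional_density (a : E) : exists k : E -> R,
  [/\ measurable_fun setT k, forall x, (0 <= k x)%R &
  forall G : E -> \bar R, measurable_fun setT G -> (forall x, 0 <= G x) ->
    \int[beta]_x (G x * (k x)%:E) = \int[pi]_z (G z.2 * (\1_(cylinder a) z)%:E)].
Proof.
have mi : measurable_fun setT (fun z : E * E => (\1_(cylinder a) z : R)%:E).
  exact/measurable_EFinP/measurable_indic.
have i0 z : 0 <= (\1_(cylinder a) z : R)%:E by rewrite lee_fin.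
have [m mE] := density_measure pi mi i0.
pose ma : {measure set E -> \bar R} :=
  measure_function_pushforward__canonical__measure_function_Measure m
    (@measurable_snd _ _ E E).
have maI (G : E -> \bar R) : measurable_fun setT G -> (forall x, 0 <= G x) ->
    \int[ma]_x G x = \int[pi]_z (G z.2 * (\1_(cylinder a) z)%:E).
  move=> mG G0; rewrite ge0_integral_pushforward// preimage_setT.
  have mGs : measurable_fun setT (G \o (@snd E E)).
    by apply: measurableT_comp => //; exact: measurable_snd.
  by rewrite (ge0_integral_density mi i0 _ (fun A _ => mE A) mGs)// => z /=.
have mab A : measurable A -> ma A <= beta A.
  move=> mA; rewrite /ma /= /pushforward mE -(cpl mA).2 /pushforward.
  have mA' : measurable ((@snd E E) @^-1` A).
    by rewrite -[X in measurable X]setTI; exact: measurable_snd.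
  rewrite integral_indic//; apply: le_measure; rewrite ?inE//.
  by apply: measurableI => //; exact: measurable_cylinder.
have mafin : fin_num_fun ma.
  move=> A mA; rewrite ge0_fin_numE// (le_lt_trans (mab _ mA))//.
  by rewrite ltey_eq fin_num_measure.
have [mF mFE] := fin_num_finite_measure mafin.
have dom : mF `<< beta.
  apply/null_content_dominatesP => A mA A0; apply/eqP.
  rewrite -measure_le0 -A0; apply: le_trans (mab _ mA).
  by rewrite mFE.
have [f [f0 ffin fi fE]] := radon_nikodym_sigma_finite dom.
have mf : measurable_fun setT f by exact: measurable_int fi.
exists (fine \o f); split.
- exact: measurableT_comp.
- by move=> x; exact: fine_ge0.
- move=> G mG G0; rewrite -maI// mFE.
  rewrite (ge0_integral_density mf f0 ffin fE mG G0).
  by apply: eq_integral => x _; rewrite /= fineK.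
Qed.

(** Sample points may coincide; the density of a shared point is divided equally among its
    indices. *)
Let mult (i : 'I_n) : R := #|[pred j | X j == X i]|%:R.

Let mult_gt0 i : (0 < mult i)%R.
Proof. by rewrite ltr0n; apply/card_gt0P; exists i; rewrite inE. Qed.

Let empirical_pt i : empirical X [set X i] = (mult i / n%:R)%:E.
Proof.
rewrite /empirical; under eq_bigr do rewrite diracE.
rewrite sumEFin -EFinM mulrC; congr ((_ * _)%:E).
rewrite -natr_sum; congr (_%:R); rewrite -sum1_card [RHS]big_mkcond/=.
apply: eq_bigr => j _; rewrite inE; case: eqP => [->|ji]; first by rewrite mem_set.
by rewrite memNset.
Qed.

Let sum_cylinder (z : E * E) : (exists i, X i = z.1) ->
  (\sum_i (mult i)^-1 * \1_(cylinder (X i)) z = 1 :> R)%R.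
Proof.
move=> [i0 zi0].
have indE i : (\1_(cylinder (X i)) z = (X i == X i0)%:R :> R)%R.
  rewrite indicE; congr (nat_of_bool _)%:R; apply/idP/eqP.
    by rewrite inE => -[/= zi _]; rewrite zi0 -zi.
  by move=> XE; rewrite inE; split => //=; rewrite XE zi0.
rewrite (eq_bigr (fun i => if X i == X i0 then (mult i0)^-1 else 0)%R); last first.
  move=> i _; rewrite indE; case: eqP => [XE|_]; last by rewrite mulr0.
  by rewrite mulr1 /mult XE.
rewrite -big_mkcond/= sumr_const -[RHS](mulVf (lt0r_neq0 (mult_gt0 i0))).
by rewrite -[LHS]mulr_natr.
Qed.

Let support_ae : {ae pi, forall z, exists i, X i = z.1}.
Proof.
pose D : set E := \bigcup_(i in [set: 'I_n]) [set X i].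
have mD : measurable D.
  by apply: fin_bigcup_measurable => // i _; exact: measurable_set1_rV.
exists ((@fst E E) @^-1` (~` D)); split.
- by rewrite -[X in measurable X]setTI; apply: measurable_fst => //; exact: measurableC.
- have := (cpl (measurableC mD)).1; rewrite /pushforward => ->.
  rewrite /empirical big1 ?mule0// => i _; rewrite diracE memNset//=.
  by apply; exists i.
- by move=> z /= zX [i _ /= zi]; apply: zX; exists i.
Qed.

(** [k i x] is the conditional probability, given [x], of the index [i]. The weights sum to 1 at
    every [x], since they are later evaluated at [S y]; their equality at coinciding points lets the
    marginals of the candidate have a density on the sample. *)
Lemma semidiscrete_coupling : exists k : 'I_n -> E -> R,
  [/\ forall i, measurable_fun setT (k i), forall i x, (0 <= k i x)%R,
      forall x, (\sum_i k i x = 1)%R /\ forall i j, X i = X j -> k i x = k j x,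
      forall i, \int[beta]_x (k i x)%:E = (n%:R^-1)%:E &
      forall F : E * E -> R, measurable_fun setT F -> (forall z, 0 <= F z)%R ->
        \sum_i \int[beta]_x (F (X i, x) * k i x)%:E = \int[pi]_z (F z)%:E].
Proof.
have [k0 k0P] := choice conditional_density.
have mk0 a : measurable_fun setT (k0 a) by have [] := k0P a.
have k0_ge0 a x : (0 <= k0 a x)%R by have [] := k0P a.
pose k1 i x : R := ((mult i)^-1 * k0 (X i) x)%R.
have mk1 i : measurable_fun setT (k1 i) by exact: measurable_funM.
have k1_ge0 i x : (0 <= k1 i x)%R by rewrite mulr_ge0// invr_ge0 ltW.
have k1I (F : E * E -> R) : measurable_fun setT F -> (forall z, 0 <= F z)%R ->
    \sum_i \int[beta]_x (F (X i, x) * k1 i x)%:E = \int[pi]_z (F z)%:E.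
  move=> mF F0.
  have mFX i : measurable_fun setT (fun x => F (X i, x)).
    by apply: (measurableT_comp mF); exact: measurable_pair1.
  transitivity (\sum_i \int[pi]_z (F z * ((mult i)^-1 * \1_(cylinder (X i)) z))%:E).
    apply: eq_bigr => i _; have [_ _ kI] := k0P (X i).
    under eq_integral do rewrite mulrCA EFinM.
    rewrite ge0_integralZl_EFin ?invr_ge0 ?ltW//; last 2 first.
    - by move=> x _; rewrite lee_fin mulr_ge0.
    - by apply/measurable_EFinP; exact: measurable_funM.
    under [RHS]eq_integral do rewrite mulrCA EFinM.
    rewrite ge0_integralZl_EFin ?invr_ge0 ?ltW//; last 2 first.
    - by move=> x _; rewrite lee_fin mulr_ge0.
    - by apply/measurable_EFinP; exact: measurable_funM.
    congr (_ * _); under eq_integral do rewrite EFinM.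
    rewrite (kI (fun x => (F (X i, x))%:E)); last 2 first.
    - exact/measurable_EFinP.
    - by move=> x; rewrite lee_fin.
    apply: eq_integral => z _; rewrite -EFinM; congr (_%:E).
    rewrite indicE; have [zi|zi] := boolP (z \in cylinder (X i)); last by rewrite !mulr0.
    by move: zi; rewrite inE => -[/= <- _]; rewrite -surjective_pairing.
  rewrite -ge0_integral_sum//; last 2 first.
  - move=> i; apply/measurable_EFinP; apply: measurable_funM => //.
    exact: measurable_funM.
  - by move=> i z _; rewrite lee_fin mulr_ge0// mulr_ge0// invr_ge0 ltW.
  apply: ge0_ae_eq_integral => //.
  - apply: emeasurable_sum => i; apply/measurable_EFinP; apply: measurable_funM => //.
    exact: measurable_funM.
  - exact/measurable_EFinP.
  - move=> z _; apply: sume_ge0 => i _.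
    by rewrite lee_fin mulr_ge0// mulr_ge0// invr_ge0 ltW.
  - by move=> z _; rewrite lee_fin.
  - apply: filterS support_ae => z zX _.
    by rewrite sumEFin -mulr_sumr sum_cylinder// mulr1.
pose s x : R := (\sum_i k1 i x)%R.
have ms : measurable_fun setT s by exact: measurable_sum.
(* The weights [k1] sum to [1] only almost everywhere: on the exceptional null set
   they are replaced below by [1/n]. *)
have s1 : {ae beta, forall x, s x = 1%R}.
  (* Applied to the indicator of the second-coordinate preimage of [B], [k1I] shows that [s] and 1
     have the same integral over every measurable [B]. *)
  have /ae_eq_sym : ae_eq beta setT (cst 1) (EFin \o s).
    apply: integral_ae_eq => //.
    - exact: finite_measure_integrable_cst.
    - exact/measurable_EFinP.
    - move=> B _ mB; transitivity (beta B); first by rewrite integral_cst// mul1e.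
      transitivity (pi ((@snd E E) @^-1` B)); first exact: (esym (cpl mB).2).
      have mB' : measurable ((@snd E E) @^-1` B).
        by rewrite -[X in measurable X]setTI; exact: measurable_snd.
      have i0 (z : E * E) : (0 <= \1_((@snd E E) @^-1` B) z :> R)%R by rewrite indicE.
      transitivity (\int[pi]_z (\1_((@snd E E) @^-1` B) z)%:E).
        by rewrite integral_indic// setIT.
      rewrite -(k1I _ (measurable_indic mB') i0) [RHS]integral_mkcond -ge0_integral_sum//; last 2 first.
      + move=> i; apply/measurable_EFinP; apply: measurable_funM => //.
        by apply: (measurableT_comp (measurable_indic mB')); exact: measurable_pair1.
      + by move=> i x _; rewrite lee_fin mulr_ge0// indicE.
      apply: eq_integral => x _; rewrite sumEFin.
      rewrite (eq_bigr (fun i => \1_B x * k1 i x)%R) -?mulr_sumr; last first.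
        by move=> i _; rewrite !indicE.
      by rewrite patchE indicE; case: (x \in B); rewrite ?mul1r ?mul0r.
  by apply: filterS => x /(_ I) [].
pose A := s @^-1` [set 1%R].
have mA : measurable A.
  by rewrite -[X in measurable X]setTI; apply: ms => //; exact: measurable_set1.
pose k i x : R := (k1 i x * \1_A x + n%:R^-1 * (1 - \1_A x))%R.
have kE : {ae beta, forall x, forall i, k i x = k1 i x}.
  apply: filterS s1 => x sx i; rewrite /k indicE mem_set//.
  by rewrite mulr1 subrr mulr0 addr0.
have k_ge0 i x : (0 <= k i x)%R.
  rewrite addr_ge0 ?mulr_ge0 ?invr_ge0//; rewrite indicE ?subr_ge0//.
have mk i : measurable_fun setT (k i).
  apply: measurable_funD; apply: measurable_funM => //.
  by apply: measurable_funB.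
exists k; split => //.
- move=> x; split=> [|i j ij]; last by rewrite /k /k1 /mult ij.
  rewrite big_split/= -mulr_suml -/(s x) sumr_const card_ord.
  rewrite indicE; have [|xA] := boolP (x \in A).
    by rewrite inE => ->; rewrite mulr1 subrr mulr0 mul0rn addr0.
  rewrite mulr0 add0r subr0 mulr1 -[LHS]mulr_natr mulVf//.
  by rewrite pnatr_eq0 -lt0n.
- move=> i; transitivity (\int[beta]_x (k1 i x)%:E).
    apply: ge0_ae_eq_integral => //.
    - exact/measurable_EFinP.
    - exact/measurable_EFinP.
    - by move=> x _; rewrite lee_fin.
    - by move=> x _; rewrite lee_fin.
    - by apply: filterS kE => x kx _; rewrite kx.
  under eq_integral do rewrite EFinM.
  rewrite ge0_integralZl_EFin ?invr_ge0 ?ltW//; last 2 first.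
  - by move=> x _; rewrite lee_fin.
  - exact/measurable_EFinP.
  have [_ _ kI] := k0P (X i).
  have -> : \int[beta]_x (k0 (X i) x)%:E = pi (cylinder (X i)).
    transitivity (\int[beta]_x (cst 1 x * (k0 (X i) x)%:E)).
      by apply: eq_integral => x _; rewrite mul1e.
    rewrite kI//; transitivity (\int[pi]_z (\1_(cylinder (X i)) z)%:E).
      by apply: eq_integral => z _; rewrite mul1e.
    by rewrite integral_indic// setIT.
  have := (cpl (measurable_set1_rV (X i))).1; rewrite /pushforward empirical_pt.
  rewrite (_ : _ @^-1` _ = cylinder (X i)); last first.
    by apply/seteqP; split => [z /= zi|z [/= zi _]].
  move=> ->; rewrite -EFinM; congr (_%:E).
  by rewrite mulrA mulVf ?mul1r// gt_eqF.
- move=> F mF F0; rewrite -k1I//; apply: eq_bigr => i _.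
  have mFX : measurable_fun setT (fun x => F (X i, x)).
    by apply: (measurableT_comp mF); exact: measurable_pair1.
  apply: ge0_ae_eq_integral => //.
  - by apply/measurable_EFinP; exact: measurable_funM.
  - by apply/measurable_EFinP; exact: measurable_funM.
  - by move=> x _; rewrite lee_fin mulr_ge0.
  - by move=> x _; rewrite lee_fin mulr_ge0.
  - by apply: filterS kE => x kx _; rewrite kx.
Qed.

End semidiscrete_coupling.

(** * The candidate plan and its duality gap *)

Section primal_candidate.
Context {R : realType} {d : nat}.
Local Notation E := 'rV[R]_d.

(** The left side is the Bregman divergence of [s] from [expR (- p)]. Bounding [p + ln s] by
    [expR p * s - 1] turns it into the square, uniformly as [s] approaches 0. *)
Lemma bregman_le (s p : R) : 0 <= s ->
  entropy s + p * s - (1 - expR (- p)) <= expR p * (s - expR (- p)) ^+ 2.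
Proof.
move=> s0; have ep := expR_gt0 p; have en := expR_gt0 (- p).
have pn : expR p * expR (- p) = 1 by rewrite expRxMexpNx_1.
have sq : expR p * (s - expR (- p)) ^+ 2 = expR p * s ^+ 2 - 2 * s + expR (- p).
  rewrite (_ : _ * _ = expR p * s ^+ 2 - 2 * s * (expR p * expR (- p)) +
    expR (- p) * (expR p * expR (- p))); first by rewrite pn !mulr1.
  by ring.
suff : s * ln s + p * s <= expR p * s ^+ 2 - s by rewrite sq /entropy; lra.
move: s0; rewrite le_eqVlt => /predU1P[<-|s0].
  by rewrite !mul0r !mulr0 expr0n mulr0 subr0 addr0.
have := expR_ge1Dx (p + ln s); rewrite expRD lnK// => h.
have : s * (1 + (p + ln s)) <= s * (expR p * s) by rewrite ler_wpM2l// ltW.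
lra.
Qed.

(** The indicators of coinciding points add up, hence the division by the multiplicity. *)
Lemma measurable_interpolation n (X : 'I_n -> E) (f : 'I_n -> R) :
  (forall i, 0 <= f i) -> (forall i j, X i = X j -> f i = f j) ->
  exists g : E -> R, [/\ measurable_fun setT g, forall x, 0 <= g x &
    forall i, g (X i) = f i].
Proof.
move=> f0 fX; pose mult i : R := #|[pred j | X j == X i]|%:R.
have mult0 i : 0 < mult i by rewrite ltr0n; apply/card_gt0P; exists i; rewrite inE.
exists (fun x => \sum_i (f i / mult i) * \1_[set X i] x); split.
- apply: measurable_sum => i; apply: measurable_funM => //.
  exact: (measurable_indic (measurable_set1_rV (X i))).
- by move=> x; apply: sumr_ge0 => i _; rewrite mulr_ge0 ?divr_ge0 ?indicE// ltW.
- move=> i; rewrite (eq_bigr (fun j => if X j == X i then f i / mult i else 0)).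
    rewrite -big_mkcond/= sumr_const -[LHS]mulr_natr divfK//.
    exact/lt0r_neq0/mult0.
  move=> j _; rewrite indicE; case: eqP => [ji|ji].
    by rewrite mem_set//= mulr1 (fX _ _ ji) /mult ji.
  by rewrite memNset ?mulr0// => /= ij; apply: ji.
Qed.

Section one_marginal.
Variables (Omega : set E) (mu : {finite_measure set E -> \bar R}) (phi : E -> R).
Variables (M L p : R) (x0 : E) (k : E -> R).
Hypothesis clO : closed Omega.
Hypothesis muO : supported_on Omega mu.
Hypothesis Ox0 : Omega x0.
Hypothesis phiM : forall x, Omega x -> `|phi x| <= M.
Hypothesis lip : lipschitz_norm2 Omega L (fun x => expR (- phi x)).
Hypothesis mphi : measurable_fun Omega phi.
Hypothesis bk : bounded_measurable setT k.
Hypothesis k0 : forall x, 0 <= k x.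
Hypothesis p0 : 0 < p.
Hypothesis kp : Rintegral mu setT k = p.

Local Notation a := ((fun x => expR (- phi x)) \_ Omega).

Let mO : measurable Omega.
Proof. exact: measurable_closed_rV. Qed.

Let ba : bounded_measurable setT (a : E -> R).
Proof.
apply: restrict_bounded_measurable => //.
by apply/bounded_measurable_expR/bounded_measurableN; split => //; exists M.
Qed.

Let alpha := Rintegral mu setT (fun x => k x * a x).

(** Jensen's inequality for the probability density [k / p]: the square lies above its tangent at
    the mean [alpha / p], and the left side is the integral of [k] times that tangent. *)
Lemma jensen_sqr (e : R) :
  p * (alpha / p - e) ^+ 2 <= Rintegral mu setT (fun x => k x * (a x - e) ^+ 2).
Proof.
set f := alpha / p.
have I g : bounded_measurable setT g -> mu.-integrable setT (EFin \o g).
  exact: bounded_measurable_integrable.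
have bka : bounded_measurable setT (fun x => k x * a x) by exact: bounded_measurableM.
have b1 : bounded_measurable setT (fun x => 2 * (f - e) * (k x * a x)).
  exact: bounded_measurableZ.
have b2 : bounded_measurable setT (fun x => ((f - e) ^+ 2 - 2 * (f - e) * f) * k x).
  exact: bounded_measurableZ.
have -> : p * (f - e) ^+ 2 = Rintegral mu setT (fun x => 2 * (f - e) * (k x * a x) +
    ((f - e) ^+ 2 - 2 * (f - e) * f) * k x).
  rewrite RintegralD//; [|exact: I..].
  rewrite !RintegralZl//; [|exact: I..].
  have -> : Rintegral mu setT (fun x => k x * a x) = f * p.
    by rewrite /f divfK// gt_eqF.
  rewrite kp; ring.
apply: le_Rintegral => //.
- exact/I/bounded_measurableD.
- apply: I; apply: bounded_measurableM => //.
  under eq_fun do rewrite expr2.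
  by apply: bounded_measurableM; apply: bounded_measurableB => //;
    exact: bounded_measurable_cst.
- move=> x _; rewrite -subr_ge0.
  rewrite (_ : _ - _ = k x * (a x - f) ^+ 2); last by ring.
  by rewrite mulr_ge0// sqr_ge0.
Qed.

Local Open Scope ereal_scope.

(** [alpha / p] is the [k]-average of [expR (- phi x)], compared with its value at the sample point
    [x0]. [bregman_le] makes the comparison quadratic, with [expR M] bounding [expR (phi x0)];
    Jensen and the Lipschitz bound then give squared displacements. *)
Lemma entropy_gap_le :
  (p * (entropy (alpha / p) + phi x0 * (alpha / p) - (1 - expR (- phi x0))))%:E <=
  (expR M * L ^+ 2)%:E * \int[mu]_x (norm2 (x0 - x) ^+ 2 * k x)%:E.
Proof.
have f0 : (0 <= alpha / p)%R.
  rewrite divr_ge0 ?(ltW p0)//; apply: Rintegral_ge0 => x _.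
  by rewrite mulr_ge0// patchE; case: ifP => // _; exact: expR_ge0.
have mn : measurable_fun setT (fun x : E => (norm2 (x0 - x) ^+ 2)%R).
  rewrite (_ : (fun _ => _) = fun x => (2 * cost (x0, x).1 (x0, x).2)%R); last first.
    by apply/funext => x /=; rewrite /cost mulrA mulfV// mul1r.
  apply: measurable_funM => //.
  by apply: (measurableT_comp (@measurable_cost R d)); exact: measurable_pair1.
have bke : bounded_measurable setT (fun x => k x * (a x - expR (- phi x0)) ^+ 2)%R.
  apply: bounded_measurableM => //; under eq_fun do rewrite expr2.
  by apply: bounded_measurableM; apply: bounded_measurableB => //;
    exact: bounded_measurable_cst.
apply: (@le_trans _ _ ((expR M)%:E *
    (Rintegral mu setT (fun x => k x * (a x - expR (- phi x0)) ^+ 2))%R%:E)).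
  rewrite -EFinM lee_fin.
  apply: (@le_trans _ _ (expR M * (p * (alpha / p - expR (- phi x0)) ^+ 2))%R).
    rewrite [leRHS]mulrCA ler_wpM2l ?(ltW p0)//.
    apply: (le_trans (bregman_le (phi x0) f0)).
    rewrite ler_wpM2r ?sqr_ge0// ler_expR.
    by rewrite (le_trans (ler_norm _))// phiM.
  by rewrite ler_wpM2l ?expR_ge0// jensen_sqr.
rewrite EFinM -muleA lee_wpmul2l ?lee_fin ?expR_ge0//.
rewrite -integral_bounded_measurable// -ge0_integralZl_EFin ?sqr_ge0//; last 2 first.
- by move=> x _; rewrite lee_fin mulr_ge0// sqr_ge0.
- by apply/measurable_EFinP; apply: measurable_funM => //; case: bk.
apply: ae_ge0_le_integral => //.
- by move=> x _; rewrite lee_fin mulr_ge0// sqr_ge0.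
- by apply/measurable_EFinP; case: bke.
- by move=> x _; rewrite lee_fin mulr_ge0 ?sqr_ge0// mulr_ge0// sqr_ge0.
- apply/measurable_EFinP; apply: measurable_funM => //.
  by apply: measurable_funM => //; case: bk.
- apply: filterS (supported_ae mO muO) => x Ox _.
  rewrite -EFinM lee_fin [leRHS]mulrA [leRHS]mulrC ler_wpM2l// patchE mem_set//.
  rewrite norm2_distC -exprMn -(real_normK (num_real (_ - _))).
  have h := lip Ox Ox0.
  by rewrite ler_pXn2r ?nnegrE// (le_trans _ h).
Qed.

End one_marginal.

Section candidate.
Variables (Omega : set E) (mu nu : {finite_measure set E -> \bar R}).
Variables (phi psi : E -> R) (S : E -> E) (M L K p q : R) (n m : nat).
Variables (X : 'I_n -> E) (Y : 'I_m -> E).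
Variables (k : 'I_n -> E -> R) (l : 'I_m -> E -> R).
Variables (mun nun : {measure set E -> \bar R}).
Hypothesis clO : closed Omega.
Hypotheses (muO : supported_on Omega mu) (nuO : supported_on Omega nu).
Hypotheses (mphi : measurable_fun Omega phi) (mpsi : measurable_fun Omega psi).
Hypotheses (phiM : forall x, Omega x -> `|phi x| <= M)
  (psiM : forall x, Omega x -> `|psi x| <= M).
Hypotheses (lphi : lipschitz_norm2 Omega L (fun x => expR (- phi x)))
  (lpsi : lipschitz_norm2 Omega L (fun x => expR (- psi x))).
Hypothesis mS : measurable_fun setT S.
Hypothesis adm : forall x y, Omega x -> Omega y -> phi x + psi y <= cost x y.
Hypotheses (K0 : 0 <= K) (L0 : 0 <= L).
Hypothesis gapS : {ae nu, forall y, Omega y -> forall z w, Omega z -> Omega w ->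
  cost z w - phi z - psi w <= K * (norm2 (z - S y) ^+ 2 + norm2 (w - y) ^+ 2)}.
Local Notation a := ((fun x => expR (- phi x)) \_ Omega).
Local Notation b := ((fun y => expR (- psi y)) \_ Omega).
Hypothesis transportS : forall F : E -> \bar R, measurable_fun setT F ->
  (forall x, 0 <= F x)%E ->
  (\int[mu]_x (F x * (a x)%:E) = \int[nu]_y (F (S y) * (b y)%:E))%E.
Hypotheses (XO : forall i, Omega (X i)) (YO : forall j, Omega (Y j)).
Hypotheses (mk : forall i, measurable_fun setT (k i))
  (ml : forall j, measurable_fun setT (l j)).
Hypotheses (k0 : forall i x, 0 <= k i x) (l0 : forall j y, 0 <= l j y).
Hypotheses (k1 : forall x, \sum_i k i x = 1) (l1 : forall y, \sum_j l j y = 1).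
Hypotheses (kX : forall x i j, X i = X j -> k i x = k j x)
  (lY : forall y i j, Y i = Y j -> l i y = l j y).
Hypotheses (p0 : 0 < p) (q0 : 0 < q).
Hypotheses (kp : forall i, (\int[mu]_x (k i x)%:E = p%:E)%E)
  (lq : forall j, (\int[nu]_y (l j y)%:E = q%:E)%E).
Hypotheses (munE : forall F : E -> R, measurable_fun setT F ->
    (\int[mun]_x (F x)%:E = (\sum_i p * F (X i))%:E)%E)
  (nunE : forall F : E -> R, measurable_fun setT F ->
    (\int[nun]_y (F y)%:E = (\sum_j q * F (Y j))%:E)%E).

Let unit_bounded (N : nat) (f : 'I_N -> E -> R) : (forall i, measurable_fun setT (f i)) ->
  (forall i x, 0 <= f i x) -> (forall x, \sum_i f i x = 1) ->
  forall i, bounded_measurable setT (f i).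
Proof.
move=> mf f0 f1 i; split=> //; exists 1 => x _; rewrite ger0_norm// -(f1 x).
by rewrite (bigD1 i)//= lerDl sumr_ge0.
Qed.

Let bk := unit_bounded mk k0 k1.
Let bl := unit_bounded ml l0 l1.
Let mO : measurable Omega.
Proof. exact: measurable_closed_rV. Qed.

Let restrict_expR (f : E -> R) : measurable_fun Omega f ->
  (forall x, Omega x -> `|f x| <= M) ->
  bounded_measurable setT ((fun x => expR (- f x)) \_ Omega : E -> R).
Proof.
move=> mf fM; apply: restrict_bounded_measurable => //.
by apply/bounded_measurable_expR/bounded_measurableN; split => //; exists M.
Qed.

Let ba := restrict_expR mphi phiM.
Let bb := restrict_expR mpsi psiM.

Let a0 x : 0 <= a x.
Proof. by rewrite patchE; case: ifP => // _; exact: expR_ge0. Qed.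

Let b0 x : 0 <= b x.
Proof. by rewrite patchE; case: ifP => // _; exact: expR_ge0. Qed.

Let bkS i : bounded_measurable setT (fun y => k i (S y)).
Proof.
have [mki [N kN]] := bk i; split; first exact: measurableT_comp.
by exists N => y _; exact: kN.
Qed.

(* The optimal plan of [UOT mu nu] is the image of [exp (- psi) nu] under [(S, id)];
   the weights [k] and [l] carry it over to the pairs of sample points. *)
Let plan i j := Rintegral nu setT (fun y => k i (S y) * l j y * b y).
Let alpha i := Rintegral mu setT (fun x => k i x * a x).
Let beta j := Rintegral nu setT (fun y => l j y * b y).

Let bplan i j : bounded_measurable setT (fun y => k i (S y) * l j y * b y).
Proof. by apply: bounded_measurableM => //; exact: bounded_measurableM. Qed.

Let plan_ge0 i j : 0 <= plan i j.
Proof. by apply: Rintegral_ge0 => y _; rewrite !mulr_ge0. Qed.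

Let planE i j : (\int[nu]_y (k i (S y) * l j y * b y)%:E = (plan i j)%:E)%E.
Proof. exact: integral_bounded_measurable. Qed.

Let alpha_ge0 i : 0 <= alpha i.
Proof. by apply: Rintegral_ge0 => y _; rewrite mulr_ge0. Qed.

Let beta_ge0 i : 0 <= beta i.
Proof. by apply: Rintegral_ge0 => y _; rewrite mulr_ge0. Qed.

(** Summing out [l] leaves [k i (S y)] integrated against the weighted [nu], which [transportS]
    turns into [k i] against the weighted [mu]. *)
Let sum_plan_r i : \sum_j plan i j = alpha i.
Proof.
apply: EFin_inj; rewrite -sumEFin; under eq_bigr do rewrite -planE.
rewrite -ge0_integral_sum//; last 2 first.
- by move=> j; apply/measurable_EFinP; case: (bplan i j).
- by move=> j y _; rewrite lee_fin !mulr_ge0.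
rewrite -integral_bounded_measurable//; last exact: bounded_measurableM.
under [RHS]eq_integral do rewrite EFinM.
rewrite (transportS (F := fun x => (k i x)%:E)); last 2 first.
- by apply/measurable_EFinP; case: (bk i).
- by move=> x; rewrite lee_fin.
apply: eq_integral => y _; rewrite sumEFin -EFinM; congr (_%:E).
by rewrite -mulr_suml -mulr_sumr l1 mulr1.
Qed.

Let sum_plan_l j : \sum_i plan i j = beta j.
Proof.
apply: EFin_inj; rewrite -sumEFin; under eq_bigr do rewrite -planE.
rewrite -ge0_integral_sum//; last 2 first.
- by move=> i; apply/measurable_EFinP; case: (bplan i j).
- by move=> i y _; rewrite lee_fin !mulr_ge0.
rewrite -integral_bounded_measurable//; last exact: bounded_measurableM.
apply: eq_integral => y _; rewrite sumEFin; congr (_%:E).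
by rewrite -mulr_suml -mulr_suml k1 mul1r.
Qed.

(** The density with respect to the discrete [zn] is [w i / r] at [Z i], which is well defined at
    coinciding points because [w] agrees there. *)
Let KL_le (N : nat) (Z : 'I_N -> E) (r : R) (w : 'I_N -> R)
    (eta : set E -> \bar R) (zn : {measure set E -> \bar R}) : 0 < r ->
  (forall i, 0 <= w i) -> (forall i j, Z i = Z j -> w i = w j) ->
  (forall F : E -> R, measurable_fun setT F ->
    (\int[zn]_x (F x)%:E = (\sum_i r * F (Z i))%:E)%E) ->
  (forall A, measurable A -> eta A = (\sum_i w i * \1_A (Z i))%:E) ->
  (KL eta zn <= (\sum_i r * entropy (w i / r))%:E)%E.
Proof.
move=> r0 w0 wZ znE etaE.
have [| |f [mf f0 fZ]] := @measurable_interpolation N Z (fun i => w i / r).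
- by move=> i; rewrite divr_ge0 ?(ltW r0).
- by move=> i j /wZ ->.
apply: ereal_inf_lbound; exists f.
  split=> // A mA; rewrite integral_mkcond restrict_EFin etaE//.
  have mfA : measurable_fun setT (f \_ A).
    by apply/(measurable_restrict _ mA measurableT); rewrite setTI; exact: measurable_funTS.
  rewrite (znE _ mfA); congr (_%:E); apply: eq_bigr => i _.
  rewrite patchE indicE; case: (Z i \in A); rewrite ?mulr0// mulr1 fZ.
  by rewrite mulrC divfK// gt_eqF.
rewrite (znE (fun x => entropy (f x))); last exact: measurableT_comp (@measurable_entropy R) mf.
by congr (_%:E); apply: eq_bigr => i _; rewrite fZ.
Qed.

Local Open Scope ereal_scope.

Let UOT_candidate : UOT Omega mun nun <=
  (\sum_i \sum_j plan i j * cost (X i) (Y j) +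
   \sum_i p * entropy (alpha i / p) + \sum_j q * entropy (beta j / q))%:E.
Proof.
have [g gE gI] := @discrete_measure _ (E * E)%type R ('I_n * 'I_m)%type
  (fun ij => plan ij.1 ij.2) (fun ij => (X ij.1, Y ij.2)) (fun ij => plan_ge0 ij.1 ij.2).
apply: le_trans (ereal_inf_lbound _) _.
  exists g => //=; rewrite /supported_on gE; last first.
    by apply: measurableC; exact: measurableX.
  rewrite big1// => -[i j] _; rewrite diracE memNset ?mule0//= => nO; apply: nO.
  by split => /=.
rewrite !EFinD; apply: leeD; first apply: leeD.
- rewrite -/(cost _ _) (gI (fun z => cost z.1 z.2)); last exact: measurable_cost.
  by rewrite lee_fin pair_bigA/=.
- apply: (KL_le (Z := X)) => //; first by move=> i j ij; rewrite /alpha;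
    under eq_fun do rewrite (kX _ ij).
  move=> A mA; rewrite /pushforward gE; last first.
    by rewrite -[X in measurable X]setTI; exact: measurable_fst.
  under eq_bigr do rewrite diracE.
  under eq_bigr do rewrite -EFinM.
  rewrite sumEFin; congr (_%:E).
  rewrite -(pair_bigA _ (fun i j => plan i j * (X i \in A)%:R)%R)/=.
  by apply: eq_bigr => i _; rewrite -mulr_suml sum_plan_r indicE.
- apply: (KL_le (Z := Y)) => //; first by move=> i j ij; rewrite /beta;
    under eq_fun do rewrite (lY _ ij).
  move=> A mA; rewrite /pushforward gE; last first.
    by rewrite -[X in measurable X]setTI; exact: measurable_snd.
  under eq_bigr do rewrite diracE.
  under eq_bigr do rewrite -EFinM.
  rewrite sumEFin; congr (_%:E).
  rewrite -(pair_bigA _ (fun i j => plan i j * (Y j \in A)%:R)%R)/= exchange_big/=.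
  by apply: eq_bigr => i _; rewrite -mulr_suml sum_plan_l indicE.
Qed.

Let mcost2 (z : E) : measurable_fun setT (fun x : E => (norm2 (z - x) ^+ 2)%R).
Proof.
rewrite (_ : (fun _ => _) = fun x => (2 * cost (z, x).1 (z, x).2)%R); last first.
  by apply/funext => x /=; rewrite /cost mulrA mulfV// mul1r.
apply: measurable_funM => //.
by apply: (measurableT_comp (@measurable_cost R d)); exact: measurable_pair1.
Qed.

Let Imu := \sum_i \int[mu]_x (norm2 (X i - x) ^+ 2 * k i x)%:E.
Let Inu := \sum_j \int[nu]_y (norm2 (Y j - y) ^+ 2 * l j y)%:E.

Let Imu_ge0 : 0 <= Imu.
Proof.
apply: sume_ge0 => i _; apply: integral_ge0 => x _.
by rewrite lee_fin mulr_ge0// sqr_ge0.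
Qed.

Let Inu_ge0 : 0 <= Inu.
Proof.
apply: sume_ge0 => i _; apply: integral_ge0 => x _.
by rewrite lee_fin mulr_ge0// sqr_ge0.
Qed.

Let weighted_le (N : nat) (Z : 'I_N -> E) (f : 'I_N -> E -> R) (c : E -> R)
    (eta : {finite_measure set E -> \bar R}) :
  (forall i, measurable_fun setT (f i)) -> (forall i x, 0 <= f i x)%R ->
  measurable_fun setT c -> (forall x, 0 <= c x <= expR M)%R ->
  \int[eta]_x ((\sum_i norm2 (Z i - x) ^+ 2 * f i x)%:E * (c x)%:E) <=
  (expR M)%:E * \sum_i \int[eta]_x (norm2 (Z i - x) ^+ 2 * f i x)%:E.
Proof.
move=> mf f0 mc c0.
have mt i : measurable_fun setT (fun x : E => (norm2 (Z i - x) ^+ 2 * f i x)%R).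
  exact: measurable_funM.
have t0 i x : (0 <= norm2 (Z i - x) ^+ 2 * f i x)%R by rewrite mulr_ge0// sqr_ge0.
rewrite -ge0_integral_sum//; last 2 first.
- by move=> i; exact/measurable_EFinP.
- by move=> i x _; rewrite lee_fin.
rewrite -ge0_integralZl_EFin ?expR_ge0//; last 2 first.
- by move=> x _; apply: sume_ge0 => i _; rewrite lee_fin.
- by apply: emeasurable_sum => i; exact/measurable_EFinP.
apply: ge0_le_integral => //.
- move=> x _; rewrite -EFinM lee_fin mulr_ge0 ?sumr_ge0//.
  by have /andP[] := c0 x.
- apply: emeasurable_funM; apply/measurable_EFinP => //.
  exact: measurable_sum.
- apply: emeasurable_funM => //.
  by apply: emeasurable_sum => i; exact/measurable_EFinP.
- move=> x _; rewrite sumEFin -!EFinM lee_fin mulrC ler_wpM2r ?sumr_ge0//.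
  by have /andP[] := c0 x.
Qed.

Let exp_bound f (fM : forall x, Omega x -> (`|f x| <= M)%R) x :
  (0 <= ((fun x => expR (- f x)) \_ Omega) x <= expR M)%R.
Proof.
rewrite patchE; case: ifPn => [/[!inE] Ox|_]; last by rewrite lexx expR_ge0.
by rewrite expR_ge0 ler_expR (le_trans (ler_norm _))// normrN fM.
Qed.

(** The pair [(S y, y)] is displaced to [(X i, Y j)] at a gap bounded by [gapS]. Since both families
    of weights sum to 1, the squared displacements separate into [U] and [V], and [transportS]
    brings the term in [S y] back to [mu]. *)
Let gap_sum_le :
  (\sum_i \sum_j plan i j * (cost (X i) (Y j) - phi (X i) - psi (Y j)))%:E <=
  (K * expR M)%:E * (Imu + Inu).
Proof.
pose G i j := (cost (X i) (Y j) - phi (X i) - psi (Y j))%R.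
have G0 i j : (0 <= G i j)%R by have := adm (XO i) (YO j); rewrite /G; lra.
have [ma _] := ba; have [mb _] := bb.
have mkS i : measurable_fun setT (fun y => k i (S y)) by case: (bkS i).
pose U y := (\sum_i norm2 (X i - S y) ^+ 2 * k i (S y))%R.
pose V (y : E) := (\sum_j norm2 (Y j - y) ^+ 2 * l j y)%R.
have U0 y : (0 <= U y)%R by apply: sumr_ge0 => i _; rewrite mulr_ge0// sqr_ge0.
have V0 y : (0 <= V y)%R by apply: sumr_ge0 => i _; rewrite mulr_ge0// sqr_ge0.
have mU' : measurable_fun setT (fun x : E => (\sum_i norm2 (X i - x) ^+ 2 * k i x)%R).
  by apply: measurable_sum => i; exact: measurable_funM.
have mU : measurable_fun setT U by exact: measurableT_comp mU' mS.
have mV : measurable_fun setT V.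
  by apply: measurable_sum => i; exact: measurable_funM.
have step1 : (\sum_i \sum_j plan i j * G i j)%:E =
    \int[nu]_y (\sum_i \sum_j G i j * (k i (S y) * l j y * b y))%:E.
  rewrite -sumEFin.
  under [RHS]eq_integral do rewrite -sumEFin.
  rewrite ge0_integral_sum//; last 2 first.
  - move=> i; apply/measurable_EFinP; apply: measurable_sum => j.
    by apply: measurable_funM => //; case: (bplan i j).
  - by move=> i y _; rewrite lee_fin sumr_ge0// => j _; rewrite !mulr_ge0.
  apply: eq_bigr => i _; rewrite -sumEFin.
  under [RHS]eq_integral do rewrite -sumEFin.
  rewrite ge0_integral_sum//; last 2 first.
  - move=> j; apply/measurable_EFinP.
    by apply: measurable_funM => //; case: (bplan i j).
  - by move=> j y _; rewrite lee_fin !mulr_ge0.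
  apply: eq_bigr => j _; under [RHS]eq_integral do rewrite EFinM.
  rewrite ge0_integralZl_EFin//; last 2 first.
  - by move=> y _; rewrite lee_fin !mulr_ge0.
  - by apply/measurable_EFinP; case: (bplan i j).
  by rewrite planE -EFinM mulrC.
have step2 : \int[nu]_y (\sum_i \sum_j G i j * (k i (S y) * l j y * b y))%:E <=
    \int[nu]_y (K%:E * ((U y)%:E * (b y)%:E + (V y)%:E * (b y)%:E)).
  apply: ae_ge0_le_integral => //.
  - by move=> y _; rewrite lee_fin sumr_ge0// => i _; rewrite sumr_ge0// => j _; rewrite !mulr_ge0.
  - apply/measurable_EFinP; apply: measurable_sum => i; apply: measurable_sum => j.
    by apply: measurable_funM => //; case: (bplan i j).
  - move=> y _; apply: mule_ge0; first by rewrite lee_fin.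
    by apply: adde_ge0; apply: mule_ge0; rewrite lee_fin.
  - apply: emeasurable_funM => //; apply: emeasurable_funD;
      by apply: emeasurable_funM; apply/measurable_EFinP.
  - apply: filterS2 gapS (supported_ae mO nuO) => y gy Oy _.
    rewrite (_ : K%:E * (_ + _) = (K * (U y + V y) * b y)%:E); last first.
      by rewrite -mulrA mulrDl EFinM EFinD !EFinM.
    rewrite lee_fin.
    apply: (@le_trans _ _ (\sum_i \sum_j (K * (norm2 (X i - S y) ^+ 2 + norm2 (Y j - y) ^+ 2))
        * (k i (S y) * l j y * b y))%R).
      apply: ler_sum => i _; apply: ler_sum => j _.
      by rewrite ler_wpM2r ?mulr_ge0// gy.
    rewrite le_eqVlt; apply/orP; left; apply/eqP.
    have -> : (K * (U y + V y) * b y = \sum_i (K * b y * (norm2 (X i - S y) ^+ 2 * k i (S y)) +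
        K * b y * k i (S y) * V y))%R.
      rewrite big_split/= -mulr_sumr -/(U y) -mulr_suml -mulr_sumr k1; ring.
    apply: eq_bigr => i _.
    have -> : (V y = \sum_j norm2 (Y j - y) ^+ 2 * l j y)%R by [].
    rewrite -[X in (_ = X + _)%R]mulr1 -(l1 y) !mulr_sumr -big_split/=.
    by apply: eq_bigr => j _; ring.
rewrite -/(G _ _) step1 (le_trans step2)// ge0_integralZl//; last 2 first.
- by apply: emeasurable_funD; apply: emeasurable_funM; apply/measurable_EFinP.
- by move=> y _; apply: adde_ge0; apply: mule_ge0; rewrite lee_fin.
rewrite EFinM -muleA lee_wpmul2l ?lee_fin// ge0_integralD//; last 4 first.
- by move=> y _; apply: mule_ge0; rewrite lee_fin.
- by apply: emeasurable_funM; apply/measurable_EFinP.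
- by move=> y _; apply: mule_ge0; rewrite lee_fin.
- by apply: emeasurable_funM; apply/measurable_EFinP.
rewrite ge0_muleDr//; apply: leeD; last exact: (weighted_le Y nu ml l0 mb (exp_bound psiM)).
rewrite -(transportS (F := fun x => (\sum_i norm2 (X i - x) ^+ 2 * k i x)%:E)); last 2 first.
- exact/measurable_EFinP.
- by move=> x; rewrite lee_fin sumr_ge0// => i _; rewrite mulr_ge0// sqr_ge0.
exact: (weighted_le X mu mk k0 ma (exp_bound phiM)).
Qed.

Lemma UOT_discrete_le : UOT Omega mun nun <=
  (\sum_i p * (1 - expR (- phi (X i))) + \sum_j q * (1 - expR (- psi (Y j))))%:E +
  (expR M * (K + L ^+ 2))%:E * (Imu + Inu).
Proof.
apply: (le_trans UOT_candidate).
(* [s1] collects the transport gaps, [s2] and [s3] the Bregman terms. As [plan] has marginals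
   [alpha] and [beta], the terms linear in the potentials cancel, and the value of the candidate is
   exactly the dual value at the samples plus [s1 + (s2 + s3)]. *)
pose s1 := (\sum_i \sum_j plan i j * (cost (X i) (Y j) - phi (X i) - psi (Y j)))%R.
pose s2 := (\sum_i p * (entropy (alpha i / p) + phi (X i) * (alpha i / p)
   - (1 - expR (- phi (X i)))))%R.
pose s3 := (\sum_j q * (entropy (beta j / q) + psi (Y j) * (beta j / q)
   - (1 - expR (- psi (Y j)))))%R.
have kpR i : Rintegral mu setT (k i) = p by rewrite /Rintegral kp.
have lqR j : Rintegral nu setT (l j) = q by rewrite /Rintegral lq.
have s2le : s2%:E <= (expR M * L ^+ 2)%:E * Imu.
  rewrite /s2 -sumEFin ge0_sume_distrr; last first.
    by move=> i _; apply: integral_ge0 => x _; rewrite lee_fin mulr_ge0// sqr_ge0.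
  apply: lee_sum => i _.
  exact: (entropy_gap_le clO muO (XO i) phiM lphi mphi (bk i) (k0 i) p0 (kpR i)).
have s3le : s3%:E <= (expR M * L ^+ 2)%:E * Inu.
  rewrite /s3 -sumEFin ge0_sume_distrr; last first.
    by move=> i _; apply: integral_ge0 => x _; rewrite lee_fin mulr_ge0// sqr_ge0.
  apply: lee_sum => j _.
  exact: (entropy_gap_le clO nuO (YO j) psiM lpsi mpsi (bl j) (l0 j) q0 (lqR j)).
have -> : (\sum_i \sum_j plan i j * cost (X i) (Y j) +
   \sum_i p * entropy (alpha i / p) + \sum_j q * entropy (beta j / q) =
   \sum_i p * (1 - expR (- phi (X i))) + \sum_j q * (1 - expR (- psi (Y j))) +
   (s1 + (s2 + s3)))%R.
  have e1 : (s1 = \sum_i \sum_j plan i j * cost (X i) (Y j) -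
      \sum_i alpha i * phi (X i) - \sum_j beta j * psi (Y j))%R.
    have -> : (\sum_j beta j * psi (Y j) = \sum_i \sum_j plan i j * psi (Y j))%R.
      rewrite exchange_big/=; apply: eq_bigr => j _.
      by rewrite -sum_plan_l mulr_suml.
    rewrite -!sumrB; apply: eq_bigr => i _; rewrite -sum_plan_r mulr_suml -!sumrB.
    by apply: eq_bigr => j _; ring.
  have e2 : (s2 = \sum_i p * entropy (alpha i / p) + \sum_i alpha i * phi (X i) -
      \sum_i p * (1 - expR (- phi (X i))))%R.
    rewrite -big_split -sumrB; apply: eq_bigr => i _ /=.
    by field; rewrite gt_eqF.
  have e3 : (s3 = \sum_i q * entropy (beta i / q) + \sum_i beta i * psi (Y i) -
      \sum_i q * (1 - expR (- psi (Y i))))%R.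
    rewrite -big_split -sumrB; apply: eq_bigr => i _ /=.
    by field; rewrite gt_eqF.
  rewrite e1 e2 e3; ring.
rewrite (_ : expR M * (K + L ^+ 2) = K * expR M + expR M * L ^+ 2)%R; last by ring.
have eM : (0 <= expR M)%R by exact: expR_ge0.
rewrite (EFinD (K * _)) ge0_muleDl ?lee_fin ?mulr_ge0 ?sqr_ge0//.
rewrite (EFinD (_ + _) (s1 + _)) leeD2l// (EFinD s1).
apply: leeD; first exact: gap_sum_le.
by rewrite (EFinD s2) ge0_muleDr//; apply: leeD.
Qed.

End candidate.
End primal_candidate.

(** * Wasserstein distance and normalization *)

Section wasserstein.
Context {R : realType} {d : nat}.
Local Notation E := 'rV[R]_d.
Local Open Scope ereal_scope.

Lemma sqr_W2 (alpha beta : set E -> \bar R) : W2 alpha beta ^+ 2 =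
  ereal_inf [set \int[pi]_z (norm2 (z.1 - z.2) ^+ 2)%:E | pi in coupling alpha beta].
Proof.
have inf_ge0 : 0 <= ereal_inf
    [set \int[pi]_z (norm2 (z.1 - z.2) ^+ 2)%:E | pi in coupling alpha beta].
  apply: le_ereal_inf_tmp => _ [pi _ <-]; apply: integral_ge0 => z _.
  by rewrite lee_fin sqr_ge0.
by rewrite /W2 poweR12_sqrt// sqr_sqrte.
Qed.

(** Passes from arbitrary couplings to both infima at once, so that no optimal coupling has to
    exist. For finite infima, the tolerances [e / (2 * c1)] and [e / (2 * c2)] add up to [e] after
    weighting. *)
Lemma le_add_ereal_inf (u : \bar R) (r c1 c2 : R) (A B : set (\bar R)) :
  (0 < c1)%R -> (0 < c2)%R -> lbound A 0 -> lbound B 0 ->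
  (forall x y, A x -> B y -> u <= r%:E + (c1%:E * x + c2%:E * y)) ->
  u <= r%:E + (c1%:E * ereal_inf A + c2%:E * ereal_inf B).
Proof.
move=> c10 c20 A0 B0 H.
have iA : 0 <= ereal_inf A by exact: le_ereal_inf_tmp.
have iB : 0 <= ereal_inf B by exact: le_ereal_inf_tmp.
have [Ay|Ay] := eqVneq (ereal_inf A) +oo.
  rewrite Ay gt0_muley ?lte_fin// addye ?addey ?leey//.
  by rewrite -ltNye (lt_le_trans _ (mule_ge0 _ iB))// lee_fin ltW.
have [By|By] := eqVneq (ereal_inf B) +oo.
  rewrite By gt0_muley ?lte_fin// !addey ?leey//.
  by rewrite -ltNye (lt_le_trans _ (mule_ge0 _ iA))// lee_fin ltW.
have fA : ereal_inf A \is a fin_num by rewrite ge0_fin_numE// ltey.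
have fB : ereal_inf B \is a fin_num by rewrite ge0_fin_numE// ltey.
apply/lee_addgt0Pr => e e0.
have e1 : (0 < e / (2 * c1))%R by rewrite divr_gt0// mulr_gt0.
have e2 : (0 < e / (2 * c2))%R by rewrite divr_gt0// mulr_gt0.
have [x Ax xlt] := lb_ereal_inf_adherent e1 fA.
have [y By' ylt] := lb_ereal_inf_adherent e2 fB.
apply: (le_trans (H _ _ Ax By')).
apply: (@le_trans _ _ (r%:E + (c1%:E * (ereal_inf A + (e / (2 * c1))%:E) +
    c2%:E * (ereal_inf B + (e / (2 * c2))%:E)))).
  rewrite leeD2l// leeD// lee_wpmul2l ?lee_fin ?(ltW c10) ?(ltW c20)//; exact: ltW.
move: (ereal_inf A) (ereal_inf B) fA fB => [a| |] [b| |]//= _ _.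
rewrite -(EFinD a) -(EFinD b) -(EFinM c1) -(EFinM c2) -(EFinD _ e).
rewrite -(EFinD (c1 * _)%R) -(EFinD r) lee_fin le_eqVlt.
by apply/orP; left; apply/eqP; field; rewrite !gt_eqF.
Qed.

End wasserstein.

Section normalization.
Context {R : realType} {d : nat}.
Local Notation E := 'rV[R]_d.
Local Open Scope ereal_scope.
Variable mu : {finite_measure set E -> \bar R}.
Hypothesis mu0 : 0 < mu setT.

Let mu_fin : mu setT \is a fin_num.
Proof. exact: fin_num_measure. Qed.

Lemma mass_gt0 : (0 < (mass mu)%:num)%R.
Proof. by rewrite /= fine_gt0// mu0/= ltey_eq mu_fin. Qed.

Lemma mass_normalized A : mu A = (mass mu)%:num%:E * normalized mu A.
Proof.
rewrite /normalized /= /mnormalize gt_eqF//=.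
have -> : (mu setT == +oo) = false by apply/negbTE; rewrite -ltey ltey_eq mu_fin.
rewrite muleCA -EFinM mulfV ?mule1//.
by rewrite gt_eqF// mass_gt0.
Qed.

Lemma integral_normalized (F : E -> \bar R) : measurable_fun setT F ->
  (forall x, 0 <= F x) ->
  \int[mu]_x F x = (mass mu)%:num%:E * \int[normalized mu]_x F x.
Proof.
move=> mF F0; rewrite -ge0_integral_mscale//.
by apply: eq_measure_integral => A mA _; exact: mass_normalized.
Qed.

Lemma integral_mscale_empirical n (X : 'I_n -> E) (F : E -> R) :
  measurable_fun setT F ->
  \int[mscale (mass mu) (empirical X)]_x (F x)%:E =
  (\sum_i ((mass mu)%:num / n%:R) * F (X i))%:E.
Proof.
move=> mF; pose r : R := ((mass mu)%:num / n%:R)%R.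
have r0 (i : 'I_n) : (0 <= r)%R by rewrite divr_ge0.
have [g gE gI] := @discrete_measure _ E R 'I_n (fun=> r) X r0.
rewrite -gI//; apply: eq_measure_integral => A mA _.
rewrite [RHS](gE A mA) /= /mscale /empirical muleA -EFinM ge0_sume_distrr//.
Qed.

Lemma density_null (p : E -> R) (N : set E) :
  has_density (normalized mu) lebesgue_rV p ->
  measurable N -> lebesgue_rV N = 0 -> mu N = 0.
Proof.
move=> [mp p0 pE] mN N0; rewrite mass_normalized pE// null_set_integral ?mule0//.
exact/measurable_EFinP/measurable_funTS.
Qed.

End normalization.

(** * The optimal map and the estimate for point configurations *)

Section duality_estimate.
Context {R : realType} {d : nat}.
Local Notation E := 'rV[R]_d.
Variables (Omega : set E) (mu nu : {finite_measure set E -> \bar R}).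
Variables (phi psi : E -> R).
Hypotheses (muO : supported_on Omega mu) (nuO : supported_on Omega nu).
Hypotheses (mu0 : (0 < mu setT)%E) (nu0 : (0 < nu setT)%E).
Hypothesis opt : optimal_dual_potentials Omega mu nu phi psi.
Hypothesis hess : hessian_bounds Omega phi.
Hypotheses (cO : compact Omega)
  (cvxO : convex_set (Omega : set (convex_lmodType E))).
Variable p : E -> R.
Hypothesis mup : has_density (normalized mu) lebesgue_rV p.

Let clO : closed Omega.
Proof. exact: compact_closed (@norm_hausdorff _ _) cO. Qed.

Let mO : measurable Omega.
Proof. exact: measurable_closed_rV. Qed.

Let O0 : Omega !=set0.
Proof.
apply/set0P; apply/negP => /eqP OE; move: mu0.
by rewrite -setC0 -OE; move: muO; rewrite /supported_on => ->; rewrite ltxx.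
Qed.

Let expR_lipschitz (f : E -> R) (M D : R) : (forall x, Omega x -> `|f x| <= M) ->
  (forall x y, Omega x -> Omega y -> `|f x - f y| <= D * norm2 (x - y)) ->
  lipschitz_norm2 Omega (expR M * D) (fun x => expR (- f x)).
Proof.
move=> fM fD.
have H x y : Omega x -> Omega y ->
    expR (- f x) - expR (- f y) <= expR M * D * norm2 (x - y).
  move=> Ox Oy; have := expR_ge1Dx (f x - f y).
  have -> : expR (- f y) = expR (- f x) * expR (f x - f y).
    by rewrite -expRD; congr expR; ring.
  move=> h; rewrite -mulrA.
  apply: (@le_trans _ _ (expR (- f x) * `|f x - f y|)).
    rewrite -[X in X - _]mulr1 -mulrBr ler_wpM2l ?expR_ge0//.
    have := ler_norm (- (f x - f y)); rewrite normrN; lra.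
  rewrite ler_pM ?expR_ge0 ?fD// ler_expR.
  by rewrite (le_trans (ler_norm _))// normrN fM.
move=> x y Ox Oy; rewrite ler_norml; apply/andP; split; last exact: H.
by rewrite lerNl opprB norm2_distC H.
Qed.

(* The data of an optimal plan of [UOT mu nu]: the map [S] sends [y] to the point
   [x] it is coupled with. *)
Lemma optimal_map : exists S : E -> E, exists2 K : R, 0 < K &
  [/\ measurable_fun setT S,
    (forall F : E -> \bar R, measurable_fun setT F -> (forall x, 0 <= F x)%E ->
      \int[mu]_x (F x * (((fun x => expR (- phi x)) \_ Omega) x)%:E) =
      \int[nu]_y (F (S y) * (((fun y => expR (- psi y)) \_ Omega) y)%:E))%E &
    {ae nu, forall y, Omega y -> forall z w, Omega z -> Omega w ->
      cost z w - phi z - psi w <= K * (norm2 (z - S y) ^+ 2 + norm2 (w - y) ^+ 2)}].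
Proof.
have [adm optE [chi chiE] psiE] := opt.
have [/= bphi bpsi ad] := adm.
have [k [k01 [H [g gP HP] Hk]]] := hess.
have /andP[k0 k1] := k01.
have taylor := taylor_bounds cvxO gP HP Hk.
have cphi : {within Omega, continuous phi} by case: bphi.
have attained := c_transform_attained cO O0 cphi psiE.
have [|S0 S0P] := @choice E E (fun y x => Omega y -> Omega x /\ psi y = cost x y - phi x).
  move=> y; have [Oy|nOy] := pselect (Omega y); last by exists 0.
  by have [x Ox xE] := attained _ Oy; exists x.
(* Extended by 0 so as to be measurable on the whole space; the weights vanish outside [Omega], so
   the value there is immaterial. *)
pose S := S0 \_ Omega.
have SE y : Omega y -> S y = S0 y by move=> Oy; rewrite /S patchE mem_set.
have SO y : Omega y -> Omega (S y) by move=> Oy; rewrite SE//; have [] := S0P _ Oy.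
have SpE y : Omega y -> psi y = cost (S y) y - phi (S y).
  by move=> Oy; rewrite SE//; have [] := S0P _ Oy.
have gap x y : Omega x -> Omega y ->
    phi x + psi y + k / 2 * norm2 (x - S y) ^+ 2 <= cost x y.
  move=> Ox Oy; rewrite sqr_norm2.
  have := gap_ge cvxO psiE taylor (SO _ Oy) Oy Ox (SpE _ Oy); lra.
have lS : lipschitz_norm2 Omega k^-1 S.
  move=> x y Ox Oy; rewrite (le_trans (mx_norm_le_norm2 _))// -ler_pdivrMl ?invr_gt0//.
  rewrite invrK.
  exact: (argmin_lipschitz cvxO psiE taylor (SO _ Ox) Ox (SO _ Oy) Oy (SpE _ Ox) (SpE _ Oy)).
have cS := lipschitz_norm2_continuous lS.
have mS : measurable_fun setT S.
  apply/(measurable_restrict _ mO measurableT); rewrite setTI.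
  have : measurable_fun Omega S by exact: within_continuous_measurable_rV.
  by apply: eq_measurable_fun => y /[!inE] Oy; rewrite SE.
have opt' q : dual_admissible Omega q ->
    (dual_objective Omega mu nu q <= dual_objective Omega mu nu (phi, psi))%E.
  by move=> qa; rewrite optE; apply: ereal_sup_ubound; exists q.
have tr (F : E -> \bar R) mF F0 := transport clO k0 cS gap bphi bpsi opt' (F := F) mF F0 mS.
exists S, ((1 + k^-1) / 2); first by rewrite divr_gt0// addr_gt0// invr_gt0.
split => //.
have [N [mN N0 NP]] := axis_interior_ae clO cvxO.
have muN : mu N = 0%E by apply: (density_null mu0 mup).
pose b := (fun y => expR (- psi y)) \_ Omega : E -> R.
have mb : measurable_fun setT b.
  apply: (restrict_bounded_measurable clO _).1.
  by apply/bounded_measurable_expR/bounded_measurableN/Cb_bounded_measurable.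
have mSN : measurable_fun setT (fun y => \1_N (S y) : R).
  exact: (measurableT_comp (measurable_indic mN) mS).
(* The exceptional set [N] is null for [mu], so the transport identity makes this integral vanish.
   The weight being positive on [Omega], [S y] avoids [N] for almost every [y] there. *)
have int0 : (\int[nu]_y ((\1_N (S y))%:E * (b y)%:E) = 0)%E.
  rewrite -(tr (fun x => (\1_N x)%:E)); last 2 first.
  - exact/measurable_EFinP/measurable_indic.
  - by move=> x; rewrite lee_fin.
  have -> : (\int[mu]_x ((\1_N x)%:E * (((fun x => expR (- phi x)) \_ Omega) x)%:E) =
      \int[mu]_(x in N) (((fun x => expR (- phi x)) \_ Omega) x)%:E)%E.
    rewrite [RHS]integral_mkcond; apply: eq_integral => x _.
    by rewrite [in RHS]patchE indicE; case: (x \in N); rewrite ?mul1e ?mul0e.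
  apply: null_set_integral => //.
  apply/measurable_EFinP/measurable_funTS.
  apply: (restrict_bounded_measurable clO _).1.
  by apply/bounded_measurable_expR/bounded_measurableN/Cb_bounded_measurable.
have ae0 : ae_eq nu setT (fun y => (\1_N (S y))%:E * (b y)%:E)%E (cst 0%E).
  apply/ae_eq_integral_abs => //.
    by apply: emeasurable_funM; exact/measurable_EFinP.
  rewrite -[RHS]int0; apply: eq_integral => y _.
  rewrite gee0_abs// mule_ge0// lee_fin// /b patchE.
  by case: ifP => // _; exact: expR_ge0.
apply: filterS ae0 => y yN Oy z w Oz Ow.
have nSN : ~ N (S y).
  move=> NSy; have := yN I; rewrite indicE mem_set//= mul1e /b patchE mem_set//.
  by move=> [] /eqP; rewrite expR_eq0.
rewrite !sqr_norm2.
apply: (gap_le cO O0 cvxO k01 cphi psiE taylor (NP _ (SO _ Oy) nSN)) => //.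
- exact: SO.
- exact: SpE.
Qed.

(** In the constant, [K] pays for the transport gaps and [L ^+ 2] for the entropies. [L] is
    [expR M * D], where [D] bounds the distances in [Omega] and is thereby a Lipschitz constant of
    both potentials. *)
Lemma UOT_empirical_le : exists2 C : R, 0 < C &
  forall (n m : nat) (X : 'I_n -> E) (Y : 'I_m -> E), (0 < n)%N -> (0 < m)%N ->
  (forall i, Omega (X i)) -> (forall j, Omega (Y j)) ->
  (UOT Omega (mscale (mass mu) (empirical X)) (mscale (mass nu) (empirical Y)) <=
   (\sum_i (mass mu)%:num / n%:R * (1 - expR (- phi (X i))) +
    \sum_j (mass nu)%:num / m%:R * (1 - expR (- psi (Y j))))%:E +
   C%:E * ((mass mu)%:num%:E * W2 (empirical X) (normalized mu) ^+ 2 +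
           (mass nu)%:num%:E * W2 (empirical Y) (normalized nu) ^+ 2))%E.
Proof.
have [[/= bphi bpsi ad] _ cc psiE] := opt.
have [S [K K0 [mS tr gapS]]] := optimal_map.
have [D D0 DP] := compact_norm2_bounded cO.
have cpsi : c_concave Omega psi by exists (EFin \o phi).
have [cphi [M1 M1P]] := bphi; have [_ [M2 M2P]] := bpsi.
pose M := `|M1| + `|M2|.
have phiM x : Omega x -> `|phi x| <= M.
  by move=> /M1P h; rewrite (le_trans h)// (le_trans (ler_norm _))// lerDl.
have psiM x : Omega x -> `|psi x| <= M.
  by move=> /M2P h; rewrite (le_trans h)// (le_trans (ler_norm _))// lerDr.
have lphi := expR_lipschitz phiM (c_concave_lipschitz DP cc).
have lpsi := expR_lipschitz psiM (c_concave_lipschitz DP cpsi).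
set L := expR M * D in lphi lpsi.
have L0 : 0 <= L by rewrite mulr_ge0 ?expR_ge0// ltW.
have [mphi _] := Cb_bounded_measurable clO bphi.
have [mpsi _] := Cb_bounded_measurable clO bpsi.
have C0 : 0 < expR M * (K + L ^+ 2).
  by rewrite mulr_gt0 ?expR_gt0// ltr_pwDl ?sqr_ge0.
exists (expR M * (K + L ^+ 2)) => // n m X Y n0 m0 XO YO.
have Mm := mass_gt0 mu0; have Mn := mass_gt0 nu0.
have W0 (al be : set E -> \bar R) : (0 <= W2 al be ^+ 2)%E.
  rewrite sqr_W2; apply: le_ereal_inf_tmp => _ [pi _ <-]; apply: integral_ge0 => z _.
  by rewrite lee_fin sqr_ge0.
have P1 : (0 <= (mass mu)%:num%:E * W2 (empirical X) (normalized mu) ^+ 2)%E.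
  by apply: mule_ge0 => //; rewrite lee_fin ltW.
have P2 : (0 <= (mass nu)%:num%:E * W2 (empirical Y) (normalized nu) ^+ 2)%E.
  by apply: mule_ge0 => //; rewrite lee_fin ltW.
rewrite (ge0_muleDr _ P1 P2) !sqr_W2 !muleA -!EFinM; apply: le_add_ereal_inf.
- exact: mulr_gt0.
- exact: mulr_gt0.
- by move=> _ [pi _ <-]; apply: integral_ge0 => z _; rewrite lee_fin sqr_ge0.
- by move=> _ [pi _ <-]; apply: integral_ge0 => z _; rewrite lee_fin sqr_ge0.
move=> _ _ [pi1 cpl1 <-] [pi2 cpl2 <-].
have [k [mk k_ge0 k1 kint kpi]] := semidiscrete_coupling n0 cpl1.
have [l [ml l_ge0 l1 lint lpi]] := semidiscrete_coupling m0 cpl2.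
have mn2 : measurable_fun setT (fun z : E * E => norm2 (z.1 - z.2) ^+ 2).
  rewrite (_ : (fun _ => _) = fun z => 2 * cost z.1 z.2); last first.
    by apply/funext => z; rewrite /cost mulrA mulfV// mul1r.
  by apply: measurable_funM => //; exact: measurable_cost.
have n2_ge0 (z : E * E) : 0 <= norm2 (z.1 - z.2) ^+ 2 by exact: sqr_ge0.
have scaled (eta : {finite_measure set E -> \bar R}) (N : nat) (Z : 'I_N -> E)
    (f : 'I_N -> E -> R) (pi : probability (E * E)%type R) (F : E * E -> R) :
    (0 < eta setT)%E -> measurable_fun setT F -> (forall z, 0 <= F z) ->
    (forall i, measurable_fun setT (f i)) -> (forall i x, 0 <= f i x) ->
    (\sum_i \int[normalized eta]_x (F (Z i, x) * f i x)%:E = \int[pi]_z (F z)%:E ->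
    \sum_i \int[eta]_x (F (Z i, x) * f i x)%:E =
      (mass eta)%:num%:E * \int[pi]_z (F z)%:E)%E.
  move=> eta0 mF F0 mf f0 <-; rewrite ge0_sume_distrr; last first.
    by move=> i _; apply: integral_ge0 => x _; rewrite lee_fin mulr_ge0.
  apply: eq_bigr => i _; apply: integral_normalized => //.
    apply/measurable_EFinP; apply: measurable_funM => //.
    by apply: (measurableT_comp mF); exact: measurable_pair1.
  by move=> x; rewrite lee_fin mulr_ge0.
have Imu : (\sum_i \int[mu]_x (norm2 (X i - x) ^+ 2 * k i x)%:E =
    (mass mu)%:num%:E * \int[pi1]_z (norm2 (z.1 - z.2) ^+ 2)%:E)%E.
  exact: (scaled mu _ X k pi1 _ mu0 mn2 n2_ge0 mk k_ge0 (kpi _ mn2 n2_ge0)).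
have Inu : (\sum_j \int[nu]_y (norm2 (Y j - y) ^+ 2 * l j y)%:E =
    (mass nu)%:num%:E * \int[pi2]_z (norm2 (z.1 - z.2) ^+ 2)%:E)%E.
  exact: (scaled nu _ Y l pi2 _ nu0 mn2 n2_ge0 ml l_ge0 (lpi _ mn2 n2_ge0)).
have mass_k (eta : {finite_measure set E -> \bar R}) (N : nat) (f : E -> R) :
    (0 < eta setT)%E -> measurable_fun setT f -> (forall x, 0 <= f x) ->
    (\int[normalized eta]_x (f x)%:E = (N%:R^-1)%:E ->
     \int[eta]_x (f x)%:E = ((mass eta)%:num / N%:R)%:E)%E.
  move=> eta0 mf f0 fN; rewrite integral_normalized//; first by rewrite fN -EFinM.
  exact/measurable_EFinP.
have := @UOT_discrete_le R d Omega mu nu phi psi S M L K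
  ((mass mu)%:num / n%:R) ((mass nu)%:num / m%:R) n m X Y k l
  (mscale (mass mu) (empirical X)) (mscale (mass nu) (empirical Y)).
rewrite Imu Inu ge0_muleDr ?mule_ge0 ?lee_fin ?(ltW Mm) ?(ltW Mn)//; last 2 first.
- by apply: integral_ge0 => z _; rewrite lee_fin.
- by apply: integral_ge0 => z _; rewrite lee_fin.
rewrite !muleA -!EFinM; apply=> //.
- exact: ltW.
- by move=> x; have [] := k1 x.
- by move=> x; have [] := l1 x.
- by move=> x; have [] := k1 x.
- by move=> x; have [] := l1 x.
- by rewrite divr_gt0// ltr0n.
- by rewrite divr_gt0// ltr0n.
- by move=> i; exact: (mass_k mu n _ mu0 (mk i) (k_ge0 i) (kint i)).
- by move=> j; exact: (mass_k nu m _ nu0 (ml j) (l_ge0 j) (lint j)).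
- exact: integral_mscale_empirical.
- exact: integral_mscale_empirical.
Qed.

End duality_estimate.

Local Open Scope ereal_scope.

Theorem proposition7 (R : realType) (d : nat) (Omega : set 'rV[R]_d)
    (mu nu : {finite_measure set 'rV[R]_d -> \bar R})
    (phi0 psi0 : 'rV[R]_d -> R) :
  supported_on Omega mu -> supported_on Omega nu ->
  0 < mu setT -> 0 < nu setT ->
  optimal_dual_potentials Omega mu nu phi0 psi0 ->
  hessian_bounds Omega phi0 ->
  regular_domain Omega ->
  bounded_densities Omega (normalized mu) (normalized nu) ->
  let zeta0 x := (1 - expR (- phi0 x))%R in
  let xi0 y := (1 - expR (- psi0 y))%R in
  exists C_Lambda : R,
    forall (n m : nat), (0 < n)%N -> (0 < m)%N ->
    forall (dT : measure_display) (T : measurableType dT) (P : probability T R)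
      (X : 'I_n -> {RV P >-> 'rV[R]_d}) (Y : 'I_m -> {RV P >-> 'rV[R]_d}),
    independent_samples Omega (normalized mu) (normalized nu) X Y ->
    forall w : T,
      let mubar_n := empirical (fun i => X i w) in
      let nubar_m := empirical (fun j => Y j w) in
      let mutilde_n := mscale (mass mu) mubar_n in
      let nutilde_m := mscale (mass nu) nubar_m in
      UOT Omega mutilde_n nutilde_m - UOT Omega mu nu <=
        (\int[mutilde_n]_(x in Omega) (zeta0 x)%:E
           - \int[mu]_(x in Omega) (zeta0 x)%:E) +
        (\int[nutilde_m]_(y in Omega) (xi0 y)%:E
           - \int[nu]_(y in Omega) (xi0 y)%:E) +
        C_Lambda%:E *
          ((mass mu)%:num%:E * W2 mubar_n (normalized mu) ^+ 2 +
           (mass nu)%:num%:E * W2 nubar_m (normalized nu) ^+ 2).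
Proof.
move=> muO nuO mu0 nu0 opt hess [cO cvxO _] [p [q [bmin [bmax [mup nuq _ _]]]]].
have [C C0 CP] := UOT_empirical_le muO nuO mu0 nu0 opt hess cO cvxO mup.
exists C => n m n0 m0 dT T P X Y [XO YO _ _ _] w /=.
have clO : closed Omega by exact: compact_closed (@norm_hausdorff _ _) cO.
have [adm _ _ _] := opt; have [/= bphi bpsi _] := adm.
have bm1 := Cb_bounded_measurable clO bphi.
have bm2 := Cb_bounded_measurable clO bpsi.
have empE (eta : {finite_measure set 'rV[R]_d -> \bar R}) (N : nat) (Z : 'I_N -> 'rV[R]_d) f :
    (forall i, Omega (Z i)) -> bounded_measurable Omega f ->
    \int[mscale (mass eta) (empirical Z)]_(x in Omega) (1 - expR (- f x))%:E =
    (\sum_i (mass eta)%:num / N%:R * (1 - expR (- f (Z i))))%:E.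
  move=> ZO bf; rewrite integral_mkcond restrict_EFin.
  rewrite (integral_mscale_empirical eta Z (F := (fun x => (1 - expR (- f x))%R) \_ Omega)).
    by congr (_%:E); apply: eq_bigr => i _; rewrite patchE mem_set.
  apply: (restrict_bounded_measurable clO _).1.
  apply: bounded_measurableB; first exact: bounded_measurable_cst.
  exact/bounded_measurable_expR/bounded_measurableN.
have := weak_duality mu nu clO adm.
rewrite /dual_objective /= !(empE _ _ _ _ _ bm1) ?(empE _ _ _ _ _ bm2)//.
rewrite !(integral_dual_restrict clO)//.
have := CP n m (fun i => X i w) (fun j => Y j w) n0 m0 (XO ^~ w) (YO ^~ w).
move: (UOT _ _ _) (UOT _ _ _) => un u.
move: (C%:E * _) => W h1 h2.
(* [h1] bounds the empirical value from above, and [h2] is weak duality for [mu] and [nu]. The dual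
   integrals are real numbers, so only a rearrangement remains, with [W] possibly infinite. *)
apply: le_trans (leeB h1 h2) _.
case: W {h1} => [r| |]; rewrite -?EFinD -?EFinN -?EFinD ?lee_fin ?leey//.
by rewrite le_eqVlt; apply/orP; left; apply/eqP; ring.
Qed.
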